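(* Let $\theta$ be a non-constant inner function and let $B$ be a bounded linear operator on $\mathcal{K}_\theta$. The identity $$B-S_\theta^*BS_\theta^*=x\otimes k_0^\theta+\widetilde{k}_0^\theta\otimes y$$ holds for some $x,y\in\mathcal{K}_\theta$ if and only if the identity $$BS_\theta-S_\theta^*B=u\otimes\widetilde{k}_0^\theta+\widetilde{k}_0^\theta\otimes v$$ holds for some $u,v\in\mathcal{K}_\theta$. More precisely, if the first identity holds with $x,y$, then the second holds with $u=-(S_\theta^*B\widetilde{k}_0^\theta+\theta(0)x)$ and $v=S_\theta^*y$; and if the second identity holds with $u,v$, then the first holds with $x=Bk_0^\theta-\overline{\theta(0)}\,u$ and $y=S_\theta v$.
   Context: $H^2\subset L^2(\mathbb{T})$ is the Hardy space of the unit circle (normalized Lebesgue measure). An inner function $\theta$ is a bounded analytic function on the unit disk with $|\theta|=1$ a.e. on $\mathbb{T}$. The model space is $\mathcal{K}_\theta=H^2\ominus\theta H^2$, $P_{\mathcal{K}_\theta}$ is the orthogonal projection of $L^2(\mathbb{T})$ onto $\mathcal{K}_\theta$, and the compressed shift is $S_\theta f=P_{\mathcal{K}_\theta}(zf)$, $f\in\mathcal{K}_\theta$. Put $k_0^\theta(z)=1-\overline{\theta(0)}\theta(z)$ and $\widetilde{k}_0^\theta(z)=\frac{\theta(z)-\theta(0)}{z}$, both in $\mathcal{K}_\theta$. $(p\otimes q)f=\langle f,q\rangle p$ (inner product linear in the first variable). *)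

(* Defs.v *)
From HB Require Import structures.
From mathcomp Require Import all_boot all_order all_algebra.
From mathcomp Require Import all_classical all_reals all_analysis.
From mathcomp Require Import complex.
Set Implicit Arguments.
Unset Strict Implicit.
Unset Printing Implicit Defensive.
Import Order.TTheory GRing.Theory Num.Theory.
Import numFieldNormedType.Exports.
Local Open Scope classical_set_scope.
Local Open Scope complex_scope.
Local Open Scope ring_scope.

(* Elements of L^2(T) are represented by functions R[i] -> R[i], of which only
   the values on the unit circle matter; equality in L^2(T) is [ae_circle].
   Operators are functions on representatives; see [bounded_op]. *)
Section Hardy.
Variable R : realType.
Local Notation C := R[i].
Local Notation mu := (@lebesgue_measure R).

Definition cis (t : R) : C := cos t +i* sin t.

Definition angles : set R := `[0, 2 * pi].

Definition circle_measurable (f : C -> C) : Prop :=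
  measurable_fun angles (fun t => complex.Re (f (cis t))) /\
  measurable_fun angles (fun t => complex.Im (f (cis t))).

(* Integral against normalized Lebesgue measure on the circle. *)
Definition circle_int (f : C -> C) : C :=
  ((2 * pi)^-1 * \int[mu]_(t in angles) complex.Re (f (cis t)))
  +i* ((2 * pi)^-1 * \int[mu]_(t in angles) complex.Im (f (cis t))).

Definition ae_circle (f g : C -> C) : Prop :=
  {ae mu, forall t, angles t -> f (cis t) = g (cis t)}.

Definition L2 : set (C -> C) := [set f | circle_measurable f /\
  (\int[mu]_(t in angles) (Normc.normc (f (cis t)) ^+ 2)%:E < +oo)%E].

Definition dot (f g : C -> C) : C := circle_int (fun z => f z * (g z)^*).

Definition norm2 (f : C -> C) : R := Num.sqrt (complex.Re (dot f f)).

Definition fourier (f : C -> C) (n : int) : C := dot f (fun z => z ^ n).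

Definition H2 : set (C -> C) :=
  [set f | L2 f /\ forall n : int, n < 0 -> fourier f n = 0].

(* One function carries both the values in the open disk and a representative
   of the boundary function (the radial limits).  The limits determine it on
   the circle only up to a null set, and [lebesgue_measure] lives on the Borel
   sets, hence the measurability clause.  The scalars of [derivable] are R[i], so
   it is complex differentiability. *)
Definition inner_function (theta : C -> C) : Prop :=
  [/\ forall z : C, `|z| < 1 -> derivable (theta : C^o -> C^o) z 1,
      exists M : C, forall z : C, `|z| < 1 -> `|theta z| <= M,
      circle_measurable theta,
      {ae mu, forall t, angles t ->
         (theta (r%:C * cis t) : C^o) @[r --> 1^'-] --> (theta (cis t) : C^o)}
    & {ae mu, forall t, angles t -> `|theta (cis t)| = 1}].

Definition nonconstant (theta : C -> C) : Prop :=
  ~ exists c : C, forall z : C, `|z| < 1 -> theta z = c.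

Definition model_space (theta : C -> C) : set (C -> C) :=
  [set f | H2 f /\ forall g, H2 g -> dot f (fun z => theta z * g z) = 0].

(* The choices below are made among functions that agree a.e. on the circle. *)
Definition orth_proj (K : set (C -> C)) (f : C -> C) : C -> C :=
  xget (fun=> 0)
    [set h | K h /\ forall g, K g -> dot (fun z => f z - h z) g = 0].

Definition adjoint (K : set (C -> C)) (A : (C -> C) -> C -> C) (g : C -> C) :
    C -> C :=
  xget (fun=> 0) [set h | K h /\ forall f, K f -> dot (A f) g = dot f h].

Definition comp_shift (theta f : C -> C) : C -> C :=
  orth_proj (model_space theta) (fun z => z * f z).

Definition shift_adj (theta : C -> C) : (C -> C) -> C -> C :=
  adjoint (model_space theta) (comp_shift theta).

Definition k0 (theta : C -> C) : C -> C := fun z => 1 - (theta 0)^* * theta z.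

Definition k0t (theta : C -> C) : C -> C := fun z => (theta z - theta 0) / z.

Definition rank1 (p q f : C -> C) : C -> C := fun z => dot f q * p z.

(* B acts on K: applied to differences, linearity and boundedness imply that B
   respects [ae_circle], so B is an operator on classes. *)
Definition bounded_op (K : set (C -> C)) (B : (C -> C) -> C -> C) : Prop :=
  [/\ forall f, K f -> K (B f),
      forall (a : C) f g, K f -> K g ->
        ae_circle (B (fun z => a * f z + g z)) (fun z => a * B f z + B g z)
    & exists M : R, forall f, K f -> norm2 (B f) <= M * norm2 f].

Definition identity1 (theta : C -> C) (B : (C -> C) -> C -> C)
    (x y : C -> C) : Prop :=
  forall f, model_space theta f ->
    ae_circle
      (fun z => B f z - shift_adj theta (B (shift_adj theta f)) z)
      (fun z => rank1 x (k0 theta) f z + rank1 (k0t theta) y f z).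

Definition identity2 (theta : C -> C) (B : (C -> C) -> C -> C)
    (u v : C -> C) : Prop :=
  forall f, model_space theta f ->
    ae_circle
      (fun z => B (comp_shift theta f) z - shift_adj theta (B f) z)
      (fun z => rank1 u (k0t theta) f z + rank1 (k0t theta) v f z).

End Hardy.

(* Main.v *)
Require Import Defs.
From mathcomp Require Import all_boot all_order all_algebra.
From mathcomp Require Import all_classical all_reals all_analysis.
From mathcomp Require Import measurable_realfun complex.
From mathcomp Require Import ring lra zify.
Import Order.TTheory GRing.Theory Num.Theory.
Import numFieldNormedType.Exports.
Local Open Scope classical_set_scope.
Local Open Scope complex_scope.
Local Open Scope ring_scope.
Set Implicit Arguments.
Unset Strict Implicit.
Unset Printing Implicit Defensive.

(** The two identities are equivalent because each is obtained from the other by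
    multiplying on the right by the compressed shift [S] or by its adjoint.  The
    defect operators of [S] have rank one,
      [S S^* = I - k0 (x) k0]  and  [S^* S = I - k0t (x) k0t],
    while [S^* k0 = - (theta 0)^* k0t] and [S k0t = - theta 0 k0].  Multiplying
    [B - S^* B S^*] by [S] and replacing [S^* S] gives [B S - S^* B] up to rank one
    terms of the required shape, and multiplying [B S - S^* B] by [S^*] goes back.
    This computation is done in [identity1_to_identity2] and
    [identity2_to_identity1].

    The projection and the adjoint are defined by a choice among the solutions
    of inner product equations, so everything rests on explicit formulas,
      [S f = z f - <f, k0t> theta]  and  [S^* f = (f - f(0)) / z]  a.e.,
    proved in [comp_shift_spec] and [shift_adj_spec]; the defect identities are
    then pointwise computations.  To see that the right-hand sides lie in the
    model space one needs that [theta H2] is contained in [H2] and that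
    [(theta g)(0) = theta(0) g(0)] for [g] in [H2], where [g(0)] is the zeroth
    Fourier coefficient ([H2_inner_mul], [inner_mul_mean]).  Both follow from
    [inner_mean] and [inner_orth]: the mean of [theta] is [theta 0], and [theta]
    integrates to 0 against every [g] all of whose Fourier coefficients of index
    at most 0 vanish.

    Here the holomorphy of [theta] in the disk comes in, and it is known only as
    pointwise complex differentiability.  Goursat's bisection
    ([closed_form_rectangle]), in logarithmic polar coordinates, yields the mean
    value property on circles, even for a continuous function that is
    differentiable only off one circle ([circle_mean_value]).  Applied to the
    difference quotient of [theta] this is Cauchy's integral formula
    ([quotient_mul_mean]); expanding the Cauchy kernel in a geometric series
    exhibits [theta (r z)], for [r < 1], as a bounded limit of polynomials on the
    unit circle ([cauchy_series]).  Two applications of dominated convergence, for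
    these polynomials and for [r] tending to 1, give [inner_mean] and
    [inner_orth]. *)

(** * Closed differential forms on rectangles *)

Lemma integrable_EFinD d (T : measurableType d) (R : realType)
  (mu : {measure set T -> \bar R}) (D : set T) (f g : T -> R) : measurable D ->
  mu.-integrable D (EFin \o f) -> mu.-integrable D (EFin \o g) ->
  mu.-integrable D (EFin \o (fun x => f x + g x)).
Proof.
move=> mD fi gi.
rewrite (_ : EFin \o _ = (EFin \o f) \+ (EFin \o g))%E; last exact/funext.
exact: integrableD.
Qed.

Lemma integrable_EFinB d (T : measurableType d) (R : realType)
  (mu : {measure set T -> \bar R}) (D : set T) (f g : T -> R) : measurable D ->
  mu.-integrable D (EFin \o f) -> mu.-integrable D (EFin \o g) ->
  mu.-integrable D (EFin \o (fun x => f x - g x)).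
Proof.
move=> mD fi gi.
rewrite (_ : EFin \o _ = (EFin \o f) \- (EFin \o g))%E; last exact/funext.
exact: integrableB.
Qed.

Section Goursat.
Variable R : realType.
Local Notation mu := (@lebesgue_measure R).

(** Written as an explicit estimate because the contour integral around a small
    rectangle is bounded directly by the error term. *)
Definition total_diff (P : R -> R -> R) (x y p q : R) : Prop :=
  forall e : R, 0 < e -> exists2 d : R, 0 < d & forall x' y',
    `|x' - x| < d -> `|y' - y| < d ->
    `|P x' y' - P x y - (p * (x' - x) + q * (y' - y))|
      <= e * (`|x' - x| + `|y' - y|).

Lemma total_diff_cts (P : R -> R -> R) x y p q : total_diff P x y p q ->
  {for x, continuous (P^~ y)} /\ {for y, continuous (P x)}.
Proof.
move=> dP; have [d d0 Pd] := dP 1 ltr01.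
have k0 : 0 < `|p| + `|q| + 2 by rewrite ltr_wpDl// addr_ge0.
have key x' y' e : 0 < e ->
    `|x' - x| + `|y' - y| < Num.min d (e / (`|p| + `|q| + 2)) ->
    `|P x' y' - P x y| < e.
  move=> e0; rewrite lt_min ltr_pdivlMr// => /andP[xyd xye].
  have xd : `|x' - x| < d by apply: le_lt_trans xyd; rewrite lerDl.
  have yd : `|y' - y| < d by apply: le_lt_trans xyd; rewrite lerDr.
  apply: le_lt_trans xye.
  rewrite -[P x' y' - P x y](subrK (p * (x' - x) + q * (y' - y))).
  apply: le_trans (ler_normD _ _) _.
  apply: le_trans (lerD (Pd _ _ xd yd) (ler_normD _ _)) _.
  rewrite !normrM mul1r.
  have := normr_ge0 p; have := normr_ge0 q.
  have := normr_ge0 (x' - x); have := normr_ge0 (y' - y); nra.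
have m0 e : 0 < e -> 0 < Num.min d (e / (`|p| + `|q| + 2)).
  by move=> e0; rewrite lt_min d0 divr_gt0.
have near_pt (u r : R) : 0 < r -> \forall z \near u, `|u - z| < r.
  by move=> r0; apply/nbhs_ballP; exists r.
split; apply/cvgrPdist_lt => e e0.
- apply: filterS (near_pt x _ (m0 e e0)) => z xz.
  by rewrite distrC; apply: key => //; rewrite subrr normr0 addr0 distrC.
- apply: filterS (near_pt y _ (m0 e e0)) => z xz.
  by rewrite distrC; apply: key => //; rewrite subrr normr0 add0r distrC.
Qed.

Lemma continuous_integrable_itv (f : R -> R) a b :
  (forall x, a <= x <= b -> {for x, continuous f}) ->
  mu.-integrable `[a, b] (EFin \o f).
Proof.
move=> cf; apply: continuous_compact_integrable; first exact: segment_compact.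
apply: continuous_in_subspaceT => x; rewrite inE/= in_itv/=; exact: cf.
Qed.

Lemma Rintegral_itv_split (f : R -> R) a b c : a <= b -> b <= c ->
  mu.-integrable `[a, c] (EFin \o f) ->
  \int[mu]_(x in `[a, c]) f x =
  \int[mu]_(x in `[a, b]) f x + \int[mu]_(x in `[b, c]) f x.
Proof.
move=> ab bc fi.
have fbc : mu.-integrable `]b, c] (EFin \o f).
  by apply: integrableS fi => //; apply: subset_itvr; rewrite bnd_simp.
have := @Rintegral_itvB _ _ _ _ b fi.
rewrite !bnd_simp => /(_ ab bc) H.
by rewrite -(Rintegral_itv_obnd_cbnd fbc) -H addrC subrK.
Qed.

Lemma le_normr_Rintegral_itv (f : R -> R) a b M : a <= b ->
  mu.-integrable `[a, b] (EFin \o f) ->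
  (forall x, a <= x <= b -> `|f x| <= M) ->
  `|\int[mu]_(x in `[a, b]) f x| <= M * (b - a).
Proof.
move=> ab fi fM; apply: le_trans (le_normr_Rintegral _ fi) _ => //.
have -> : M * (b - a) = \int[mu]_(x in `[a, b]) cst M x.
  rewrite Rintegral_cst//= lebesgue_measure_itv/= lte_fin.
  by case: ltgtP ab => //= -> _; rewrite subrr.
apply: le_Rintegral => //.
- exact: integrable_abse fi.
- by apply: continuous_integrable_itv => x _; exact: cst_continuous.
Qed.

Definition sub_rect (a0 c0 w0 h0 a c w h : R) : Prop :=
  [/\ 0 <= w /\ 0 <= h, a0 <= a /\ a + w <= a0 + w0 & c0 <= c /\ c + h <= c0 + h0].

(** Goursat's subdivision argument, for any quantity [E] attached to rectangles.
    If [E] is not 0 on the whole rectangle, one of the four quarters carries at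
    least a quarter of [`|E|], and so on; after [n] steps at least [4^-n] of it
    is left.  The chosen rectangles shrink to a point, where the second
    hypothesis bounds [`|E|] by an arbitrarily small multiple of the squared
    size, that is of [4^-n]: a contradiction.  Rectangles are given by their
    lower left corner [(a, c)] and their sides [w] and [h]. *)
Lemma bisection (E : R -> R -> R -> R -> R) (a0 c0 w0 h0 : R) :
  0 <= w0 -> 0 <= h0 ->
  (forall a c w h, sub_rect a0 c0 w0 h0 a c w h ->
    `|E a c w h| <= `|E a c (w / 2) (h / 2)| + `|E (a + w / 2) c (w / 2) (h / 2)|
      + `|E a (c + h / 2) (w / 2) (h / 2)|
      + `|E (a + w / 2) (c + h / 2) (w / 2) (h / 2)|) ->
  (forall x y, a0 <= x <= a0 + w0 -> c0 <= y <= c0 + h0 ->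
    forall e : R, 0 < e -> exists2 d : R, 0 < d & forall a c w h,
      sub_rect a0 c0 w0 h0 a c w h -> w < d -> h < d ->
      a <= x <= a + w -> c <= y <= c + h -> `|E a c w h| <= e * (w + h) ^+ 2) ->
  E a0 c0 w0 h0 = 0.
Proof.
move=> w00 h00 Esub Eloc; apply/eqP/negPn/negP => E0.
pose eta := `|E a0 c0 w0 h0|.
have eta0 : 0 < eta by rewrite normr_gt0.
pose W n : R := w0 / 2 ^+ n; pose H n : R := h0 / 2 ^+ n.
have W2 n : W n.+1 = W n / 2 by rewrite /W exprS invfM mulrCA mulrC.
have H2 n : H n.+1 = H n / 2 by rewrite /H exprS invfM mulrCA mulrC.
have Wge n : 0 <= W n by rewrite divr_ge0// exprn_ge0.
have Hge n : 0 <= H n by rewrite divr_ge0// exprn_ge0.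
pose sub n (p : R * R) := sub_rect a0 c0 w0 h0 p.1 p.2 (W n) (H n).
pose big n (p : R * R) := eta / 4 ^+ n <= `|E p.1 p.2 (W n) (H n)|.
have half_cases (x v v' x' : R) : v' = v / 2 -> 0 <= v' -> x' = x \/ x' = x + v' ->
    x <= x' /\ x' + v' <= x + v.
  by move=> v'E v'0 [->|->]; split; lra.
have step (np : nat * (R * R)) : exists q : R * R,
    sub np.1 np.2 -> big np.1 np.2 ->
    [/\ sub np.1.+1 q, big np.1.+1 q,
      np.2.1 <= q.1 /\ q.1 + W np.1.+1 <= np.2.1 + W np.1
      & np.2.2 <= q.2 /\ q.2 + H np.1.+1 <= np.2.2 + H np.1].
  case: np => n [a c] /=.
  have [sn|] := pselect (sub n (a, c)); last by exists (0, 0).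
  have [bn|] := pselect (big n (a, c)); last by exists (0, 0).
  have := Esub _ _ _ _ sn; rewrite -W2 -H2 /= => Es.
  case: sn => /= -[sw sh] [sa1 sa2] [sc1 sc2].
  have [q [qb q1 q2]] : exists q : R * R, [/\ big n.+1 q, q.1 = a \/ q.1 = a + W n.+1
      & q.2 = c \/ q.2 = c + H n.+1].
    apply: contrapT => /forallNP nq.
    have small q : (q.1 = a \/ q.1 = a + W n.+1) -> (q.2 = c \/ q.2 = c + H n.+1) ->
        `|E q.1 q.2 (W n.+1) (H n.+1)| < eta / 4 ^+ n.+1.
      move=> q1 q2; rewrite ltNge; apply/negP => b; exact: (nq q).
    have := small (a, c) (or_introl erefl) (or_introl erefl).
    have := small (a + W n.+1, c) (or_intror erefl) (or_introl erefl).
    have := small (a, c + H n.+1) (or_introl erefl) (or_intror erefl).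
    have := small (a + W n.+1, c + H n.+1) (or_intror erefl) (or_intror erefl).
    move: bn Es; rewrite /big /= exprS invfM mulrCA; lra.
  have [qa qw] := half_cases _ _ _ _ (W2 n) (Wge n.+1) q1.
  have [qc qh] := half_cases _ _ _ _ (H2 n) (Hge n.+1) q2.
  exists q => _ _; split; [|exact: qb|by split|by split].
  split; first by split; [exact: Wge|exact: Hge].
  - by split; [exact: le_trans sa1 qa|exact: le_trans qw sa2].
  - by split; [exact: le_trans sc1 qc|exact: le_trans qh sc2].
have [f fP] := choice step.
pose p := fix p n := if n is m.+1 then f (m, p m) else (a0, c0).
have pP n : sub n (p n) /\ big n (p n).
  elim: n => [|n [sn bn]] /=.
    by rewrite /sub /big /sub_rect /= /W /H !expr0 !divr1 !lexx; do !split.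
  by have [] := fP (n, p n) sn bn.
have p1 n k : (p n).1 <= (p (k + n)%N).1 /\ (p (k + n)%N).1 + W (k + n)%N <= (p n).1 + W n.
  elim: k => [|k [IH1 IH2]]; first by rewrite add0n !lexx.
  have [sk bk] := pP (k + n)%N.
  have [_ _ /= [i1 i2] _] := fP ((k + n)%N, p (k + n)%N) sk bk.
  rewrite addSn /=; split; [exact: le_trans i1|exact: le_trans IH2].
have p2 n k : (p n).2 <= (p (k + n)%N).2 /\ (p (k + n)%N).2 + H (k + n)%N <= (p n).2 + H n.
  elim: k => [|k [IH1 IH2]]; first by rewrite add0n !lexx.
  have [sk bk] := pP (k + n)%N.
  have [_ _ /= _ [i1 i2]] := fP ((k + n)%N, p (k + n)%N) sk bk.
  rewrite addSn /=; split; [exact: le_trans i1|exact: le_trans IH2].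
have nested (u v : nat -> R) : (forall n, 0 <= v n) ->
    (forall n k, u n <= u (k + n)%N /\ u (k + n)%N + v (k + n)%N <= u n + v n) ->
    exists x, forall n, u n <= x <= u n + v n.
  move=> v0 uv; exists (sup (range u)) => n.
  have ub m k : u k <= u m + v m.
    have [km|/ltnW mk] := leqP k m.
      have [+ _] := uv k (m - k)%N; rewrite subnK// => /le_trans; apply.
      by rewrite lerDl.
    have [_] := uv m (k - m)%N; rewrite subnK//; apply: le_trans.
    by rewrite lerDl.
  apply/andP; split.
    apply: ub_le_sup; last by exists n.
    by exists (u 0%N + v 0%N) => _ [k _ <-].
  apply: ge_sup; first by exists (u 0%N), 0%N.
  by move=> _ [k _ <-].
have [x xP] := nested _ _ Wge p1.
have [y yP] := nested _ _ Hge p2.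
have x0 : a0 <= x <= a0 + w0 by have := xP 0%N; rewrite /= /W expr0 divr1.
have y0 : c0 <= y <= c0 + h0 by have := yP 0%N; rewrite /= /H expr0 divr1.
have k0 : 0 < (w0 + h0) ^+ 2 + 1 by rewrite ltr_wpDl// sqr_ge0.
have e0 : 0 < eta / 2 / ((w0 + h0) ^+ 2 + 1) by rewrite !divr_gt0.
have [d d0 dP] := Eloc x y x0 y0 _ e0.
have [n nd] : exists n, w0 / 2 ^+ n < d /\ h0 / 2 ^+ n < d.
  exists (Num.truncn ((w0 + h0) / d)).
  set n := Num.truncn _.
  have nlt : (w0 + h0) / d < 2 ^+ n.
    apply: (lt_le_trans (truncnS_gt _)).
    by rewrite -natrX ler_nat ltn_expl.
  have g0 : 0 < 2 ^+ n :> R by rewrite exprn_gt0.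
  rewrite !ltr_pdivrMr//; move: nlt; rewrite ltr_pdivrMr// mulrC; split; lra.
have [sn bn] := pP n.
have := dP _ _ _ _ sn nd.1 nd.2 (xP n) (yP n).
move=> /(le_trans bn).
rewrite /W /H -mulrDl exprMn exprVn -exprM mulnC exprM.
have -> : 2 ^+ 2 = 4 :> R by rewrite -natrX.
have g0 : 0 < 4 ^- n :> R by rewrite invr_gt0 exprn_gt0.
rewrite mulrA ler_pM2r//; apply/negP; rewrite -ltNge.
have S1 : (w0 + h0) ^+ 2 / ((w0 + h0) ^+ 2 + 1) < 1.
  by rewrite ltr_pdivrMr// mul1r ltrDl.
rewrite -mulrA [X in _ * X]mulrC.
have S0 : 0 <= (w0 + h0) ^+ 2 / ((w0 + h0) ^+ 2 + 1).
  by rewrite divr_ge0// ?sqr_ge0// ltW.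
nra.
Qed.

(** Goursat's theorem in real form.  The common coefficient [q] says that the form
    [P dx + Q dy] is closed.  Around a small rectangle near [(x, y)] the affine
    parts of [P] and [Q] contribute nothing, precisely because of this, so only
    the error of total differentiability is left, and [bisection] applies. *)
Lemma closed_form_rectangle (P Q : R -> R -> R) (a b c d : R) : a <= b -> c <= d ->
  (forall x y, a <= x <= b -> c <= y <= d ->
    exists p q r, total_diff P x y p q /\ total_diff Q x y q r) ->
  \int[mu]_(x in `[a, b]) P x c + \int[mu]_(y in `[c, d]) Q b y
  = \int[mu]_(x in `[a, b]) P x d + \int[mu]_(y in `[c, d]) Q a y.
Proof.
move=> ab cd PQ.
have inP x y : a <= x <= b -> c <= y <= d -> {for x, continuous (P^~ y)}.
  by move=> xab ycd; have [p [q [r [/total_diff_cts[]]]]] := PQ x y xab ycd.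
have inQ x y : a <= x <= b -> c <= y <= d -> {for y, continuous (Q x)}.
  by move=> xab ycd; have [p [q [r [_ /total_diff_cts[]]]]] := PQ x y xab ycd.
have intP y u v : c <= y <= d -> a <= u -> v <= b ->
    mu.-integrable `[u, v] (EFin \o P^~ y).
  move=> ycd au vb; apply: continuous_integrable_itv => x /andP[ux xv]; apply: inP => //.
  by rewrite (le_trans au)// (le_trans xv).
have intQ x u v : a <= x <= b -> c <= u -> v <= d ->
    mu.-integrable `[u, v] (EFin \o Q x).
  move=> xab cu vd; apply: continuous_integrable_itv => y /andP[uy yv]; apply: inQ => //.
  by rewrite (le_trans cu)// (le_trans yv).
have quarter (e k1 k2 l1 l2 w h : R) : 0 <= e -> k1 <= w -> k2 <= w -> l1 <= h -> l2 <= h ->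
    e / 2 * (k1 + l1) + e / 2 * (k2 + l2) <= e * (w + h).
  move=> e0 A B C D; rewrite -mulrDr -mulrA ler_wpM2l//; lra.
have near_in (u x w z : R) : u <= x <= u + w -> u <= z <= u + w -> `|z - x| <= w.
  by rewrite ler_norml => /andP[A B] /andP[]; lra.
(* The integrals are hidden behind variables so that they are atoms for [lra]. *)
have [IP IPE] : exists IP, forall y u v, IP y u v = \int[mu]_(x in `[u, v]) P x y.
  by exists (fun y u v => \int[mu]_(x in `[u, v]) P x y).
have [IQ IQE] : exists IQ, forall x u v, IQ x u v = \int[mu]_(y in `[u, v]) Q x y.
  by exists (fun x u v => \int[mu]_(y in `[u, v]) Q x y).
rewrite -!IPE -!IQE.
pose E u s w h := IP s u (u + w) + IQ (u + w) s (s + h)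
  - IP (s + h) u (u + w) - IQ u s (s + h).
suff : E a c (b - a) (d - c) = 0.
  rewrite /E ![_ + (_ - _)]addrC !subrK; lra.
apply: (@bisection E); rewrite ?subr_ge0//.
- move=> u s w h [] [w0 h0]; rewrite ![_ + (_ - _)]addrC !subrK => -[au wb] [cs hd].
  have Pspl y : c <= y <= d -> IP y u (u + w) = IP y u (u + w / 2) + IP y (u + w / 2) (u + w).
    by move=> ycd; rewrite !IPE; apply: Rintegral_itv_split; [lra|lra|apply: intP].
  have Qspl x : a <= x <= b -> IQ x s (s + h) = IQ x s (s + h / 2) + IQ x (s + h / 2) (s + h).
    by move=> xab; rewrite !IQE; apply: Rintegral_itv_split; [lra|lra|apply: intQ].
  have -> : E u s w h = E u s (w / 2) (h / 2) + E (u + w / 2) s (w / 2) (h / 2)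
      + E u (s + h / 2) (w / 2) (h / 2) + E (u + w / 2) (s + h / 2) (w / 2) (h / 2).
    have uw : u + w / 2 + w / 2 = u + w by lra.
    have sh : s + h / 2 + h / 2 = s + h by lra.
    rewrite /E uw sh !Pspl ?Qspl; lra.
  do 2 apply: le_trans (ler_normD _ _) (lerD _ (lexx _)).
  exact: ler_normD.
- move=> x y; rewrite ![_ + (_ - _)]addrC !subrK => xab ycd e e0.
  have [p [q [r [dP dQ]]]] := PQ x y xab ycd.
  have [d1 d10 Pd] := dP (e / 2) ltac:(by rewrite divr_gt0).
  have [d2 d20 Qd] := dQ (e / 2) ltac:(by rewrite divr_gt0).
  exists (Num.min d1 d2); first by rewrite lt_min d10.
  move=> u s w h [] [w0 h0]; rewrite ![_ + (_ - _)]addrC !subrK => -[au wb] [cs hd].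
  have sin : c <= s <= d by rewrite cs (le_trans _ hd)// lerDl.
  have shin : c <= s + h <= d by rewrite hd (le_trans cs)// lerDl.
  have uin : a <= u <= b by rewrite au (le_trans _ wb)// lerDl.
  have uwin : a <= u + w <= b by rewrite wb (le_trans au)// lerDl.
  have sI : s <= s <= s + h by rewrite lexx lerDl.
  have shI : s <= s + h <= s + h by rewrite lexx lerDl h0.
  have uI : u <= u <= u + w by rewrite lexx lerDl.
  have uwI : u <= u + w <= u + w by rewrite lexx lerDl w0.
  rewrite !lt_min => /andP[w1 w2] /andP[h1 h2] /andP[ux xw] /andP[sy yh].
  have nw z : u <= z <= u + w -> `|z - x| <= w by apply: near_in; rewrite ux.
  have nh z : s <= z <= s + h -> `|z - y| <= h by apply: near_in; rewrite sy.
  pose fP z := P z s - P z (s + h) + q * h.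
  pose fQ z := Q (u + w) z - Q u z - q * w.
  have bP z : u <= z <= u + w -> `|fP z| <= e * (w + h).
    move=> zu.
    have ns := nh _ sI.
    have nsh := nh _ shI.
    have nz := nw _ zu.
    have := Pd z s (le_lt_trans nz w1) (le_lt_trans ns h1).
    have := Pd z (s + h) (le_lt_trans nz w1) (le_lt_trans nsh h1).
    rewrite /fP => A B.
    have := ler_normB (P z s - P x y - (p * (z - x) + q * (s - y)))
      (P z (s + h) - P x y - (p * (z - x) + q * (s + h - y))).
    have -> : (P z s - P x y - (p * (z - x) + q * (s - y))) -
      (P z (s + h) - P x y - (p * (z - x) + q * (s + h - y))) = P z s - P z (s + h) + q * h by ring.
    move=> /le_trans; apply;
      apply: le_trans (lerD B A) (quarter _ _ _ _ _ _ _ _ _ _ _ _) => //; exact: ltW.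
  have bQ z : s <= z <= s + h -> `|fQ z| <= e * (w + h).
    move=> zu.
    have ns := nw _ uI.
    have nsh := nw _ uwI.
    have nz := nh _ zu.
    have := Qd u z (le_lt_trans ns w2) (le_lt_trans nz h2).
    have := Qd (u + w) z (le_lt_trans nsh w2) (le_lt_trans nz h2).
    rewrite /fQ => A B.
    have := ler_normB (Q (u + w) z - Q x y - (q * (u + w - x) + r * (z - y)))
      (Q u z - Q x y - (q * (u - x) + r * (z - y))).
    have -> : (Q (u + w) z - Q x y - (q * (u + w - x) + r * (z - y))) -
      (Q u z - Q x y - (q * (u - x) + r * (z - y))) = Q (u + w) z - Q u z - q * w by ring.
    move=> /le_trans; apply; apply: le_trans (lerD A B) _.
    by rewrite ![`|_| + `|z - y|]addrC [w + h]addrC; apply: quarter => //; exact: ltW.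
  have iP1 : mu.-integrable `[u, u + w] (EFin \o P^~ s) by exact: intP.
  have iP2 : mu.-integrable `[u, u + w] (EFin \o P^~ (s + h)) by exact: intP.
  have iQ1 : mu.-integrable `[s, s + h] (EFin \o Q (u + w)) by exact: intQ.
  have iQ2 : mu.-integrable `[s, s + h] (EFin \o Q u) by exact: intQ.
  have icst (k u' v' : R) : mu.-integrable `[u', v'] (EFin \o cst k).
    by apply: continuous_integrable_itv => *; exact: cst_continuous.
  have cint (k u' v' : R) : u' <= v' -> \int[mu]_(x in `[u', v']) cst k x = k * (v' - u').
    move=> uv; rewrite Rintegral_cst//= lebesgue_measure_itv/= lte_fin.
    by case: ltgtP uv => //= -> _; rewrite subrr.
  have iP : \int[mu]_(z in `[u, u + w]) fP z = IP s u (u + w) - IP (s + h) u (u + w) + q * h * w.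
    rewrite RintegralD//; [|exact: integrable_EFinB|exact: icst].
    by rewrite RintegralB// (cint (q * h)) ?lerDl// !IPE [u + w]addrC addrK.
  have iQ : \int[mu]_(z in `[s, s + h]) fQ z = IQ (u + w) s (s + h) - IQ u s (s + h) - q * w * h.
    rewrite RintegralB//; [|exact: integrable_EFinB|exact: icst].
    by rewrite RintegralB// (cint (q * w)) ?lerDl// !IQE [s + h]addrC addrK.
  have -> : E u s w h = \int[mu]_(z in `[u, u + w]) fP z + \int[mu]_(z in `[s, s + h]) fQ z.
    rewrite iP iQ /E; ring.
  apply: le_trans (ler_normD _ _) _.
  have -> : e * (w + h) ^+ 2 = e * (w + h) * (u + w - u) + e * (w + h) * (s + h - s) by ring.
  apply: lerD; apply: le_normr_Rintegral_itv => //; rewrite ?lerDl//.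
  + by apply: integrable_EFinD; [|exact: integrable_EFinB|exact: icst].
  + by apply: integrable_EFinB; [|exact: integrable_EFinB|exact: icst].
Qed.

End Goursat.

(** * Real-valued modulus of complex numbers *)

Section ComplexModulus.
Variable R : realType.
Local Notation C := R[i].
Local Notation normc := (@Normc.normc R).
Local Notation Re := (@complex.Re R).
Local Notation Im := (@complex.Im R).
Implicit Types z w : C.

Lemma cReD z w : Re (z + w) = Re z + Re w. Proof. by case: z w => [a b] [c d]. Qed.
Lemma cImD z w : Im (z + w) = Im z + Im w. Proof. by case: z w => [a b] [c d]. Qed.
Lemma cReN z : Re (- z) = - Re z. Proof. by case: z. Qed.
Lemma cImN z : Im (- z) = - Im z. Proof. by case: z. Qed.
Lemma cReM z w : Re (z * w) = Re z * Re w - Im z * Im w.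
Proof. by case: z w => [a b] [c d]. Qed.
Lemma cImM z w : Im (z * w) = Re z * Im w + Im z * Re w.
Proof. by case: z w => [a b] [c d]. Qed.
Lemma Re_conjc z : Re (z^*) = Re z. Proof. by case: z. Qed.
Lemma Im_conjc z : Im (z^*) = - Im z. Proof. by case: z. Qed.
Lemma complex_eqP z w : Re z = Re w -> Im z = Im w -> z = w.
Proof. by case: z w => [a b] [c d] /= -> ->. Qed.

Lemma normc_sqr z : normc z ^+ 2 = Re z ^+ 2 + Im z ^+ 2.
Proof. by case: z => a b; rewrite /= sqr_sqrtr// addr_ge0// sqr_ge0. Qed.
Lemma normc_ge0 z : 0 <= normc z. Proof. by case: z => a b; exact: sqrtr_ge0. Qed.
Lemma normr_normc z : `|z| = (normc z)%:C. Proof. by []. Qed.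
Lemma Re_le_normc z : `|Re z| <= normc z.
Proof.
rewrite -(@ler_pXn2r _ 2) ?nnegrE ?normc_ge0// normc_sqr real_normK ?num_real//.
by rewrite lerDl sqr_ge0.
Qed.
Lemma Im_le_normc z : `|Im z| <= normc z.
Proof.
rewrite -(@ler_pXn2r _ 2) ?nnegrE ?normc_ge0// normc_sqr real_normK ?num_real//.
by rewrite lerDr sqr_ge0.
Qed.
Lemma normc_le_ReIm z : normc z <= `|Re z| + `|Im z|.
Proof.
rewrite -(@ler_pXn2r _ 2) ?nnegrE ?normc_ge0 ?addr_ge0// normc_sqr.
rewrite -(@real_normK _ (Re z)) ?num_real// -(@real_normK _ (Im z)) ?num_real//.
have := normr_ge0 (Re z); have := normr_ge0 (Im z); nra.
Qed.
Lemma normc_conj z : normc (z^*) = normc z.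
Proof. by case: z => a b /=; rewrite sqrrN. Qed.
Lemma mulcJ z : z * z^* = ((normc z) ^+ 2)%:C.
Proof.
apply: complex_eqP; rewrite normc_sqr ?cReM ?cImM Re_conjc Im_conjc /=; ring.
Qed.
Lemma normcB z w : normc (z - w) = normc (w - z).
Proof. by rewrite -normcN opprB. Qed.
Lemma normcX z n : normc (z ^+ n) = normc z ^+ n.
Proof.
elim: n => [|n IH]; first by rewrite !expr0 Normc.normc1.
by rewrite !exprS Normc.normcM IH.
Qed.
Lemma normc_real (r : R) : normc r%:C = `|r|.
Proof. by rewrite /= expr0n addr0 sqrtr_sqr. Qed.

Lemma normc_cis (t : R) : normc (cis t) = 1.
Proof. by rewrite /cis /= cos2Dsin2 sqrtr1. Qed.
Lemma cis_neq0 (t : R) : cis t != 0.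
Proof. by apply/eqP => c0; have := normc_cis t; rewrite c0 Normc.normc0 => /esym/eqP;
  rewrite oner_eq0. Qed.
Lemma cis_conjM (t : R) : cis t * (cis t)^* = 1.
Proof. by rewrite mulcJ normc_cis expr1n. Qed.
Lemma conj_cis (t : R) : (cis t)^* = (cis t)^-1.
Proof. by apply: (mulfI (cis_neq0 t)); rewrite cis_conjM divff// cis_neq0. Qed.
Lemma conj_exprz z (n : int) : (z ^ n)^* = (z^*) ^ n.
Proof.
case: n => n; first exact: (rmorphXn (@conjc R)).
rewrite !NegzE -!exprnN.
by rewrite (fmorphV (@conjc R)) (rmorphXn (@conjc R)).
Qed.

End ComplexModulus.

(** * The integral over the circle *)

Section CircleIntegral.
Variable R : realType.
Local Notation C := R[i].
Local Notation mu := (@lebesgue_measure R).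
Local Notation Re := (@complex.Re R).
Local Notation Im := (@complex.Im R).
Local Notation angles := (@angles R).
Implicit Types f g h : C -> C.

Lemma measurable_angles : measurable angles.
Proof. exact: measurable_itv. Qed.
Local Hint Resolve measurable_angles : core.

Lemma mu_angles : mu angles = (2 * pi)%:E.
Proof. by rewrite /angles lebesgue_measure_itv/= lte_fin mulr_gt0// ?pi_gt0// -EFinB subr0. Qed.

Lemma circle_measurable_eq f g : (forall t, angles t -> f (cis t) = g (cis t)) ->
  circle_measurable f -> circle_measurable g.
Proof.
move=> fg [mr mi]; split.
- by apply: eq_measurable_fun mr => t; rewrite inE => /fg ->.
- by apply: eq_measurable_fun mi => t; rewrite inE => /fg ->.
Qed.

Lemma circle_measurable_cst (c : C) : circle_measurable (fun=> c).
Proof. by split; exact: measurable_cst. Qed.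

Lemma circle_measurableD f g : circle_measurable f -> circle_measurable g ->
  circle_measurable (fun z => f z + g z).
Proof.
move=> [fr fi] [gr gi]; split.
- under eq_fun do rewrite cReD; exact: measurable_funD.
- under eq_fun do rewrite cImD; exact: measurable_funD.
Qed.

Lemma circle_measurableM f g : circle_measurable f -> circle_measurable g ->
  circle_measurable (fun z => f z * g z).
Proof.
move=> [fr fi] [gr gi]; split.
- under eq_fun do rewrite cReM.
  by apply: measurable_funB; exact: measurable_funM.
- under eq_fun do rewrite cImM.
  by apply: measurable_funD; exact: measurable_funM.
Qed.

Lemma circle_measurable_conj f : circle_measurable f ->
  circle_measurable (fun z => (f z)^*).
Proof.
move=> [fr fi]; split.
- by under eq_fun do rewrite Re_conjc.
- under eq_fun do rewrite Im_conjc; exact: measurableT_comp.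
Qed.

Lemma circle_measurable_cts f :
  (forall t, {for t, continuous (fun s => Re (f (cis s)))}) ->
  (forall t, {for t, continuous (fun s => Im (f (cis s)))}) -> circle_measurable f.
Proof.
by move=> cr ci; split; apply: measurable_funTS; exact: continuous_measurable_fun.
Qed.

Lemma circle_measurable_id : circle_measurable (fun z : C => z).
Proof.
apply: circle_measurable_cts => t; [exact: continuous_cos|exact: continuous_sin].
Qed.

Lemma circle_measurable_exprz (n : int) : circle_measurable (fun z : C => z ^ n).
Proof.
have pos (m : nat) : circle_measurable (fun z : C => z ^+ m).
  elim: m => [|m IH].
    apply: circle_measurable_eq (circle_measurable_cst 1) => t _; by rewrite expr0.
  apply: circle_measurable_eq (circle_measurableM circle_measurable_id IH) => t _.
  by rewrite exprS.
case: n => m; first exact: pos.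
apply: circle_measurable_eq (circle_measurable_conj (pos m.+1)) => t _.
by rewrite NegzE -exprnN -exprVn -conj_cis rmorphXn.
Qed.

Definition circle_integrable f : Prop :=
  mu.-integrable angles (EFin \o (fun t => Re (f (cis t)))) /\
  mu.-integrable angles (EFin \o (fun t => Im (f (cis t)))).

Lemma circle_integrable_eq f g : (forall t, angles t -> f (cis t) = g (cis t)) ->
  circle_integrable f -> circle_integrable g.
Proof.
move=> fg [mr mi]; split.
- by apply: eq_integrable mr => // t; rewrite inE/= => /fg ->.
- by apply: eq_integrable mi => // t; rewrite inE/= => /fg ->.
Qed.

Lemma circle_integrable_measurable f : circle_integrable f -> circle_measurable f.
Proof. by case=> /measurable_int/measurable_EFinP ? /measurable_int/measurable_EFinP ?. Qed.

Lemma integrable_anglesZ (f : R -> R) (k : R) :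
  mu.-integrable angles (EFin \o f) ->
  mu.-integrable angles (EFin \o (fun t => k * f t)).
Proof.
move=> fi; rewrite (_ : EFin \o _ = (fun t => k%:E * (EFin \o f) t)%E); last exact/funext.
exact: integrableZl.
Qed.

Lemma circle_integrable_lin (a : C) f g : circle_integrable f -> circle_integrable g ->
  circle_integrable (fun z => a * f z + g z).
Proof.
move=> [fr fi] [gr gi]; split.
- under eq_fun do rewrite cReD cReM; apply: integrable_EFinD => //.
  by apply: integrable_EFinB => //; exact: integrable_anglesZ.
- under eq_fun do rewrite cImD cImM; apply: integrable_EFinD => //.
  by apply: integrable_EFinD => //; exact: integrable_anglesZ.
Qed.

Lemma circle_int_lin (a : C) f g : circle_integrable f -> circle_integrable g ->
  circle_int (fun z => a * f z + g z) = a * circle_int f + circle_int g.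
Proof.
move=> [fr fi] [gr gi]; rewrite /circle_int.
under [in X in X +i* _]eq_Rintegral => t _ do rewrite cReD cReM.
under [in X in _ +i* X]eq_Rintegral => t _ do rewrite cImD cImM.
have scr := integrable_anglesZ (Re a) fr; have sci := integrable_anglesZ (Im a) fi.
have scr' := integrable_anglesZ (Im a) fr; have sci' := integrable_anglesZ (Re a) fi.
rewrite RintegralD//; last exact: integrable_EFinB.
rewrite RintegralB// RintegralZl// RintegralZl//.
rewrite RintegralD//; last exact: integrable_EFinD.
rewrite RintegralD// RintegralZl// RintegralZl//.
apply: complex_eqP; rewrite /= ?cReD ?cImD ?cReM ?cImM /=; ring.
Qed.

End CircleIntegral.

(** * Almost everywhere equality, square integrability and inner products *)

Section SquareIntegrable.
Variable R : realType.
Local Notation C := R[i].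
Local Notation mu := (@lebesgue_measure R).
Local Notation normc := (@Normc.normc R).
Local Notation Re := (@complex.Re R).
Local Notation angles := (@angles R).
Implicit Types f g h : C -> C.
Let mA : measurable angles := @measurable_angles R.
Local Hint Resolve mA : core.

(** Statements that hold almost everywhere on the circle are only combined through
    this lemma and the next one, so that the ambient null sets stay hidden. *)
Lemma ae_circle_imp (P Q : R -> Prop) : (forall t, angles t -> P t -> Q t) ->
  {ae mu, forall t, angles t -> P t} -> {ae mu, forall t, angles t -> Q t}.
Proof.
move=> PQ; apply: negligibleS => t /= nQ PP; apply: nQ => At; exact: PQ (PP At).
Qed.

Lemma ae_circle_and (P Q : R -> Prop) :
  {ae mu, forall t, angles t -> P t} -> {ae mu, forall t, angles t -> Q t} ->
  {ae mu, forall t, angles t -> P t /\ Q t}.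
Proof.
move=> aP aQ; have := negligibleU aP aQ; apply: negligibleS => t /= nPQ.
apply: contrapT => /not_orP[] /contrapT p /contrapT q; apply: nPQ => At.
by split; [exact: p|exact: q].
Qed.

Lemma ae_circle_all (P : R -> Prop) : (forall t, angles t -> P t) ->
  {ae mu, forall t, angles t -> P t}.
Proof. by move=> aP; exact: aeW. Qed.

Lemma circle_int_eq f g : (forall t, angles t -> f (cis t) = g (cis t)) ->
  circle_int f = circle_int g.
Proof.
move=> fg; rewrite /circle_int; congr (_ * _ +i* (_ * _));
  by apply: eq_Rintegral => t; rewrite inE => /fg ->.
Qed.

Lemma circle_int_ae (f g : C -> C) : circle_measurable f -> circle_measurable g ->
  ae_circle f g -> circle_int f = circle_int g.
Proof.
move=> [fr fi] [gr gi] fg; rewrite /circle_int; congr (_ * _ +i* (_ * _));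
  congr fine; apply: ae_eq_integral => //; try exact/measurable_EFinP.
- by apply: ae_circle_imp fg => t _ ->.
- by apply: ae_circle_imp fg => t _ ->.
Qed.

Lemma circle_int_cst (c : C) : circle_int (fun=> c) = c.
Proof.
have pi2 : 2 * pi != 0 :> R by rewrite mulf_neq0// gt_eqF// pi_gt0.
rewrite /circle_int !Rintegral_cst//.
rewrite (_ : fine _ = 2 * pi); last exact: (congr1 fine (@mu_angles R)).
by case: c => a b; rewrite ![_ * (2 * pi)]mulrC !mulKf.
Qed.

Lemma circle_int_conj f : circle_integrable f ->
  circle_int (fun z => (f z)^*) = (circle_int f)^*.
Proof.
move=> [fr fi]; rewrite /circle_int /=; congr (_ * _ +i* _).
  by apply: eq_Rintegral => t _; rewrite Re_conjc.
under eq_Rintegral => t _ do rewrite Im_conjc -mulN1r.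
by rewrite RintegralZl//; ring.
Qed.

Lemma circle_integrableD f g : circle_integrable f -> circle_integrable g ->
  circle_integrable (fun z => f z + g z).
Proof.
move=> fi gi; apply: circle_integrable_eq (circle_integrable_lin 1 fi gi).
by move=> t _; rewrite mul1r.
Qed.

Lemma circle_intD f g : circle_integrable f -> circle_integrable g ->
  circle_int (fun z => f z + g z) = circle_int f + circle_int g.
Proof.
move=> fi gi; rewrite -[circle_int f]mul1r -circle_int_lin//.
by apply: circle_int_eq => t _; rewrite mul1r.
Qed.

Lemma circle_integrable0 : circle_integrable (fun=> 0 : C).
Proof. by split; exact: integrable0. Qed.

Lemma circle_integrableZ (a : C) f : circle_integrable f ->
  circle_integrable (fun z => a * f z).
Proof.
move=> fi; apply: circle_integrable_eq (circle_integrable_lin a fi circle_integrable0).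
by move=> t _; rewrite addr0.
Qed.

Lemma circle_intZ (a : C) f : circle_integrable f ->
  circle_int (fun z => a * f z) = a * circle_int f.
Proof.
move=> fi; have := circle_int_lin a fi circle_integrable0.
rewrite circle_int_cst addr0 => <-.
by apply: circle_int_eq => t _; rewrite addr0.
Qed.

Lemma circle_integrable_sum n (F : nat -> C -> C) :
  (forall k, circle_integrable (F k)) ->
  circle_integrable (fun z => \sum_(k < n) F k z).
Proof.
move=> Fi; elim: n => [|n IH].
  by apply: circle_integrable_eq circle_integrable0 => t _; rewrite big_ord0.
apply: circle_integrable_eq (circle_integrableD IH (Fi n)) => t _.
by rewrite big_ord_recr.
Qed.

Lemma circle_int_sum n (F : nat -> C -> C) :
  (forall k, circle_integrable (F k)) ->
  circle_int (fun z => \sum_(k < n) F k z) = \sum_(k < n) circle_int (F k).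
Proof.
move=> Fi; elim: n => [|n IH].
  rewrite big_ord0 -[RHS](circle_int_cst (0 : C)).
  by apply: circle_int_eq => t _; rewrite big_ord0.
rewrite big_ord_recr /= -IH -circle_intD//; last exact: circle_integrable_sum.
by apply: circle_int_eq => t _; rewrite big_ord_recr.
Qed.

Lemma ae_circle_sym f g : ae_circle f g -> ae_circle g f.
Proof. by apply: ae_circle_imp => t _ ->. Qed.

Lemma ae_circle_trans f g h : ae_circle f g -> ae_circle g h -> ae_circle f h.
Proof.
move=> fg gh; apply: ae_circle_imp (ae_circle_and fg gh) => t _ [-> ->] //.
Qed.

Lemma ae_circle_lin (a : C) f f' g g' : ae_circle f f' -> ae_circle g g' ->
  ae_circle (fun z => a * f z + g z) (fun z => a * f' z + g' z).
Proof.
move=> fg gh; apply: ae_circle_imp (ae_circle_and fg gh) => t _ [-> ->] //.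
Qed.

Lemma measurable_normc2 f : circle_measurable f ->
  measurable_fun angles (fun t => normc (f (cis t)) ^+ 2).
Proof.
move=> [fr fi]; under eq_fun do rewrite normc_sqr.
by apply: measurable_funD; exact: measurable_funX.
Qed.

Lemma L2P f : L2 f <-> circle_measurable f /\
  mu.-integrable angles (EFin \o (fun t => normc (f (cis t)) ^+ 2)).
Proof.
split=> -[fm fi]; split => //.
  apply/integrableP; split; first by apply/measurable_EFinP; exact: measurable_normc2.
  by under eq_integral do rewrite /= ger0_norm ?sqr_ge0//.
by case/integrableP: fi => _; under eq_integral do rewrite /= ger0_norm ?sqr_ge0//.
Qed.

Lemma le_integrable_angles (f g : R -> R) : measurable_fun angles f ->
  (forall t, angles t -> `|f t| <= g t) -> mu.-integrable angles (EFin \o g) ->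
  mu.-integrable angles (EFin \o f).
Proof.
move=> mf fg; apply: le_integrable => //; first exact/measurable_EFinP.
by move=> t At /=; rewrite lee_fin (le_trans (fg _ At))// ler_norm.
Qed.

Lemma L2_circle_measurable f : L2 f -> circle_measurable f.
Proof. by case. Qed.

Lemma L2_lin (a : C) f g : L2 f -> L2 g -> L2 (fun z => a * f z + g z).
Proof.
move=> /L2P[fm fi] /L2P[gm gi].
have m : circle_measurable (fun z => a * f z + g z).
  exact: (circle_measurableD (circle_measurableM (circle_measurable_cst a) fm) gm).
apply/L2P; split => //.
apply: (le_integrable_angles (g := fun t => 2 * (normc a ^+ 2 * normc (f (cis t)) ^+ 2)
    + 2 * normc (g (cis t)) ^+ 2)).
- exact: (measurable_normc2 m).
- move=> t _; rewrite ger0_norm ?sqr_ge0// -exprMn -Normc.normcM.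
  have := le_normcD (a * f (cis t)) (g (cis t)).
  have := normc_ge0 (a * f (cis t) + g (cis t)).
  set x := normc _; set y := normc _; set z := normc _ => x0 xyz.
  have := sqr_ge0 (y - z); nra.
- apply: integrable_EFinD => //; apply: integrable_anglesZ => //.
  exact: integrable_anglesZ.
Qed.

Lemma L2M_integrable f g : L2 f -> L2 g -> circle_integrable (fun z => f z * g z).
Proof.
move=> /L2P[fm fi] /L2P[gm gi].
have [mr mi] := circle_measurableM fm gm.
have dom : mu.-integrable angles (EFin \o (fun t => normc (f (cis t)) ^+ 2
    + normc (g (cis t)) ^+ 2)) by exact: integrable_EFinD.
have le2 t : normc (f (cis t) * g (cis t)) <=
    normc (f (cis t)) ^+ 2 + normc (g (cis t)) ^+ 2.
  rewrite Normc.normcM.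
  have := normc_ge0 (f (cis t)); have := normc_ge0 (g (cis t)).
  have := sqr_ge0 (normc (f (cis t)) - normc (g (cis t))); nra.
split; apply: le_integrable_angles dom => // t _; apply: le_trans (le2 t).
- exact: Re_le_normc.
- exact: Im_le_normc.
Qed.

(** The bound is required only almost everywhere because an inner function is
    unimodular only almost everywhere on the circle. *)
Definition bounded_circle h : Prop := circle_measurable h /\
  exists M, {ae mu, forall t, angles t -> normc (h (cis t)) <= M}.

Lemma L2M_bounded h f : bounded_circle h -> L2 f -> L2 (fun z => h z * f z).
Proof.
move=> [hm [M hM]] /L2P[fm fi].
have m := circle_measurableM hm fm.
split => //.
have fMi : mu.-integrable angles (EFin \o (fun t => M ^+ 2 * normc (f (cis t)) ^+ 2)).
  exact: integrable_anglesZ.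
have [_] := integrableP _ _ _ fMi; apply: le_lt_trans.
apply: (@ae_ge0_le_integral _ _ _ mu angles) => //.
- by move=> t _; rewrite lee_fin sqr_ge0.
- by apply/measurable_EFinP; exact: (measurable_normc2 m).
- by apply: measurableT_comp => //; exact: measurable_int fMi.
apply: ae_circle_imp hM => t At hM /=; rewrite lee_fin (le_trans _ (ler_norm _))//.
rewrite Normc.normcM exprMn ler_wpM2r ?sqr_ge0// lerXn2r ?nnegrE ?normc_ge0 ?hM//.
by rewrite (le_trans (normc_ge0 _) hM).
Qed.

Lemma bounded_circle_pt h M : circle_measurable h ->
  (forall t, normc (h (cis t)) <= M) -> bounded_circle h.
Proof. by move=> hm hM; split => //; exists M; apply: aeW. Qed.

Lemma L2_cst (c : C) : L2 (fun=> c).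
Proof.
split; first exact: circle_measurable_cst.
rewrite integral_cst// [X in (_ * X)%E](@mu_angles R) -EFinM ltry.
by [].
Qed.

Lemma L2_eq f g : (forall t, angles t -> f (cis t) = g (cis t)) -> L2 f -> L2 g.
Proof.
move=> fg [fm fi]; split; first exact: circle_measurable_eq fm.
by apply: le_lt_trans fi; rewrite le_eqVlt; apply/orP; left; apply/eqP;
  apply: eq_integral => t; rewrite inE => /fg ->.
Qed.

Lemma bounded_L2 h : bounded_circle h -> L2 h.
Proof.
move=> hb; apply: L2_eq (L2M_bounded hb (L2_cst 1)) => t _; exact: mulr1.
Qed.

Lemma bounded_exprz (n : int) : bounded_circle (fun z : C => z ^ n).
Proof.
apply: (@bounded_circle_pt _ 1); first exact: circle_measurable_exprz.
move=> t; case: n => n; rewrite ?NegzE -?exprnN ?Normc.normcV ?normcX normc_cis expr1n//.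
by rewrite invr1.
Qed.

Lemma L2_exprz (n : int) : L2 (fun z : C => z ^ n).
Proof. exact/bounded_L2/bounded_exprz. Qed.

Lemma L2_conj f : L2 f -> L2 (fun z => (f z)^*).
Proof.
move=> [fm fi]; split; first exact: circle_measurable_conj.
by under eq_integral do rewrite normc_conj.
Qed.

Lemma L2_integrable f : L2 f -> circle_integrable f.
Proof.
move=> fL; apply: circle_integrable_eq (L2M_integrable fL (L2_cst 1)).
by move=> t _; rewrite mulr1.
Qed.

Lemma dot_integrable f g : L2 f -> L2 g -> circle_integrable (fun z => f z * (g z)^*).
Proof. by move=> fL gL; apply: L2M_integrable => //; exact: L2_conj. Qed.

Lemma dot_linl (a : C) f g h : L2 f -> L2 g -> L2 h ->
  dot (fun z => a * f z + g z) h = a * dot f h + dot g h.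
Proof.
move=> fL gL hL; rewrite /dot -circle_int_lin; try exact: dot_integrable.
by apply: circle_int_eq => t _; rewrite mulrDl mulrA.
Qed.

Lemma dotC f g : L2 f -> L2 g -> dot g f = (dot f g)^*.
Proof.
move=> fL gL; rewrite /dot -circle_int_conj; last exact: dot_integrable.
by apply: circle_int_eq => t _; rewrite rmorphM/= conjCK mulrC.
Qed.

Lemma dot_linr (a : C) f g h : L2 f -> L2 g -> L2 h ->
  dot h (fun z => a * f z + g z) = a^* * dot h f + dot h g.
Proof.
move=> fL gL hL; rewrite dotC//; last exact: L2_lin.
by rewrite dot_linl// rmorphD rmorphM/= -!dotC.
Qed.

Lemma dot_ae f f' g : L2 f -> L2 f' -> L2 g -> ae_circle f f' -> dot f g = dot f' g.
Proof.
move=> [fm _] [fm' _] [gm _] ff'; apply: circle_int_ae.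
- by apply: circle_measurableM => //; exact: circle_measurable_conj.
- by apply: circle_measurableM => //; exact: circle_measurable_conj.
- by apply: ae_circle_imp ff' => t _ ->.
Qed.

Lemma dot_aer f g g' : L2 f -> L2 g -> L2 g' -> ae_circle g g' -> dot f g = dot f g'.
Proof. by move=> fL gL gL' gg'; rewrite dotC// (dot_ae gL gL' fL gg') -dotC. Qed.

Lemma dot0l f : dot (fun=> 0) f = 0.
Proof. by rewrite -[RHS](circle_int_cst (0 : C)); apply: circle_int_eq => t _;
  rewrite mul0r. Qed.

Lemma dot_self f : Re (dot f f) = (2 * pi)^-1 * \int[mu]_(t in angles) (normc (f (cis t)) ^+ 2).
Proof.
by rewrite /dot /=; congr (_ * _); apply: eq_Rintegral => t _; rewrite mulcJ.
Qed.

Lemma dot_self_eq0 f : L2 f -> Re (dot f f) = 0 -> ae_circle f (fun=> 0).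
Proof.
move=> /L2P[fm fi]; rewrite dot_self => /eqP; rewrite mulf_eq0 invr_eq0.
rewrite mulf_eq0 pnatr_eq0/= gt_eqF ?pi_gt0//= => /eqP int0.
have : (\int[mu]_(t in angles) `|(normc (f (cis t)) ^+ 2)%:E| = 0)%E.
  under eq_integral do rewrite gee0_abs ?lee_fin ?sqr_ge0//.
  by rewrite -[LHS]fineK ?(integrable_fin_num _ fi)// -/(Rintegral _ _ _) int0.
move/(ae_eq_integral_abs mu mA (measurable_int _ fi)) => H.
apply: ae_circle_imp H => t At /= [n0].
apply: Normc.eq0_normc; apply/eqP; move/eqP: n0; by rewrite expf_eq0/=.
Qed.

End SquareIntegrable.

(** * Dominated convergence on the circle *)

Section DominatedConvergence.
Variable R : realType.
Local Notation C := R[i].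
Local Notation mu := (@lebesgue_measure R).
Local Notation normc := (@Normc.normc R).
Local Notation Re := (@complex.Re R).
Local Notation Im := (@complex.Im R).
Local Notation angles := (@angles R).
Let mA : measurable angles := @measurable_angles R.
Local Hint Resolve mA : core.

(** Convergence in the complex plane, through the real-valued modulus in which all
    the estimates are made. *)
Definition ccvg (u : nat -> C) (l : C) : Prop :=
  forall e : R, 0 < e -> \forall k \near \oo, normc (u k - l) < e.

Lemma ccvgP (u : nat -> C) (l : C) : ccvg u l <->
  ((fun k => Re (u k)) @ \oo --> Re l) /\ ((fun k => Im (u k)) @ \oo --> Im l).
Proof.
split=> [ul|[ur ui] e e0].
  split; apply/cvgrPdist_lt => e e0; apply: filterS (ul e e0) => k; rewrite normcB;
    apply: le_lt_trans.
  - by rewrite -cReN -cReD; exact: Re_le_normc.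
  - by rewrite -cImN -cImD; exact: Im_le_normc.
have e2 : 0 < e / 2 by rewrite divr_gt0.
move/cvgrPdist_lt : ur => /(_ _ e2) ur; move/cvgrPdist_lt : ui => /(_ _ e2) ui.
apply: filterS2 ur ui => k ur ui; rewrite normcB.
apply: le_lt_trans (normc_le_ReIm _) _; rewrite cReD cImD cReN cImN.
by rewrite [e]splitr ltrD.
Qed.

Lemma ccvg_unique u l l' : ccvg u l -> ccvg u l' -> l = l'.
Proof.
move=> /ccvgP[r i] /ccvgP[r' i']; apply: complex_eqP.
- exact: (cvg_unique (@norm_hausdorff _ R) r r').
- exact: (cvg_unique (@norm_hausdorff _ R) i i').
Qed.

Lemma ccvg_cst c : ccvg (fun=> c) c.
Proof. by apply/ccvgP; split; exact: cvg_cst. Qed.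

Lemma Rintegral_dct (f_ : nat -> R -> R) (f G : R -> R) :
  (forall k, measurable_fun angles (f_ k)) -> measurable_fun angles f ->
  mu.-integrable angles (EFin \o G) ->
  (forall k t, angles t -> `|f_ k t| <= G t) ->
  {ae mu, forall t, angles t -> (fun k => f_ k t) @ \oo --> f t} ->
  (fun k => \int[mu]_(t in angles) f_ k t) @ \oo --> \int[mu]_(t in angles) f t.
Proof.
move=> mf_ mf Gi fG cf.
have [] := @dominated_convergence _ _ R mu angles mA (fun k => EFin \o f_ k)
  (EFin \o f) (EFin \o G) _ _ _ Gi _.
- by move=> k; apply/measurable_EFinP; exact: mf_.
- exact/measurable_EFinP.
- apply: ae_circle_imp cf => t At H; apply: cvg_EFin; first exact: nearW.
  exact: H.
- by apply: aeW => t k At /=; rewrite lee_fin fG.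
move=> fi _ H.
apply: fine_cvg; rewrite fineK//; exact: integrable_fin_num fi.
Qed.

(** The factor [g] is fixed and only [h_] varies, uniformly bounded by [M]; so
    [M * (`|Re g| + `|Im g|)] dominates both the real and the imaginary part of
    the products. *)
Lemma circle_int_dct (h_ : nat -> C -> C) (h g : C -> C) (M : R) :
  (forall k, circle_measurable (h_ k)) -> circle_measurable h ->
  circle_integrable g ->
  (forall k t, angles t -> normc (h_ k (cis t)) <= M) ->
  {ae mu, forall t, angles t -> ccvg (fun k => h_ k (cis t)) (h (cis t))} ->
  ccvg (fun k => circle_int (fun z => h_ k z * g z)) (circle_int (fun z => h z * g z)).
Proof.
move=> mh_ mh gi hM ch.
have mg := circle_integrable_measurable gi.
have [gr gI] := gi.
have Gi : mu.-integrable angles (EFin \o (fun t => M * (`|Re (g (cis t))| + `|Im (g (cis t))|))).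
  apply: integrable_anglesZ; apply: integrable_EFinD => //.
  - exact: (integrable_abse gr).
  - exact: (integrable_abse gI).
have dom k t : angles t -> normc (h_ k (cis t) * g (cis t)) <=
    M * (`|Re (g (cis t))| + `|Im (g (cis t))|).
  move=> At; rewrite Normc.normcM; apply: ler_pM; rewrite ?normc_ge0//.
    exact: hM.
  exact: normc_le_ReIm.
have cvg : {ae mu, forall t, angles t ->
   ccvg (fun k => h_ k (cis t) * g (cis t)) (h (cis t) * g (cis t))}.
  apply: ae_circle_imp ch => t At ch e e0.
  have n1 : 0 < normc (g (cis t)) + 1 by rewrite ltr_wpDl// normc_ge0.
  apply: filterS (ch (e / (normc (g (cis t)) + 1)) _); last by rewrite divr_gt0.
  move=> k; rewrite ltr_pdivlMr// => hk; rewrite -mulrBl Normc.normcM.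
  by apply: le_lt_trans hk; rewrite ler_wpM2l ?normc_ge0// lerDl.
apply/ccvgP; split; rewrite /circle_int /=; apply: cvgMr; apply: Rintegral_dct Gi _ _.
- by move=> k; case: (circle_measurableM (mh_ k) mg).
- by case: (circle_measurableM mh mg).
- by move=> k t At; apply: le_trans (dom k t At); exact: Re_le_normc.
- by apply: ae_circle_imp cvg => t At /ccvgP[].
- by move=> k; case: (circle_measurableM (mh_ k) mg).
- by case: (circle_measurableM mh mg).
- by move=> k t At; apply: le_trans (dom k t At); exact: Im_le_normc.
- by apply: ae_circle_imp cvg => t At /ccvgP[].
Qed.

End DominatedConvergence.

(** * The mean value property *)

Section Polar.
Variable R : realType.
Local Notation C := R[i].
Local Notation mu := (@lebesgue_measure R).
Local Notation normc := (@Normc.normc R).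
Local Notation Re := (@complex.Re R).
Local Notation Im := (@complex.Im R).

(** The exponential of [s + i t].  In these coordinates circles around 0 become
    vertical segments, and a holomorphic function of [polar s t] is a
    holomorphic function of [s + i t]. *)
Definition polar (s t : R) : C := (expR s)%:C * cis t.

Lemma Re_polar s t : Re (polar s t) = expR s * cos t.
Proof. by rewrite /polar cReM /= mul0r subr0. Qed.
Lemma Im_polar s t : Im (polar s t) = expR s * sin t.
Proof. by rewrite /polar cImM /= mul0r addr0. Qed.

Lemma normc_polar s t : normc (polar s t) = expR s.
Proof. by rewrite Normc.normcM normc_cis normc_real mulr1 ger0_norm// expR_ge0. Qed.

Lemma polarD s t s' t' : polar (s + s') (t + t') = polar s t * polar s' t'.
Proof.
apply: complex_eqP.
- rewrite [RHS]cReM !Re_polar !Im_polar expRD cosD; ring.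
- rewrite [RHS]cImM !Re_polar !Im_polar expRD sinD; ring.
Qed.

Lemma derive_first_order (f : R -> R) (df : R) : is_derive (0 : R) 1 f df ->
  forall e : R, 0 < e -> exists2 d : R, 0 < d & forall x, `|x| < d ->
    `|f x - f 0 - df * x| <= e * `|x|.
Proof.
move=> /is_derive1_caratheodory [g [fg cg g0]] e e0.
move/cvgrPdist_le : cg => /(_ _ e0) /nbhs_ballP[d d0 gd].
exists d => // x xd; rewrite fg subr0 -mulrBl normrM ler_wpM2r//.
rewrite distrC -g0; apply: gd; by rewrite /ball /= sub0r normrN.
Qed.

(** The derivative of the exponential at the origin, from which [polarD] carries it
    to every other point. *)
Lemma polar_first_order0 (e : R) : 0 < e -> exists2 d : R, 0 < d & forall s t,
  `|s| < d -> `|t| < d -> normc (polar s t - 1 - (s +i* t)) <= e * (`|s| + `|t|).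
Proof.
(* With [e <= 1] products of two small quantities are absorbed by one factor [e / 8]. *)
wlog e1 : e / e <= 1.
  move=> H e0; have [e1|/ltW e1] := leP e 1; first exact: H.
  have [d d0 dP] := H 1 (lexx _) ltr01; exists d => // s t sd td.
  apply: le_trans (dP _ _ sd td) _; rewrite ler_wpM2r// addr_ge0//.
move=> e0; have e8 : 0 < e / 8 by rewrite divr_gt0.
have [d1 d10 D1] := derive_first_order (is_derive_expR (0 : R)) e8.
have [d2 d20 D2] := derive_first_order (is_derive_cos (0 : R)) e8.
have [d3 d30 D3] := derive_first_order (is_derive_sin (0 : R)) e8.
exists (Num.min (e / 8) (Num.min d1 (Num.min d2 d3))).
  by rewrite !lt_min e8 d10 d20.
move=> s t; rewrite !lt_min => /and4P[se s1 s2 s3] /and4P[te t1 t2 t3].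
apply: le_trans (normc_le_ReIm _) _.
rewrite !cReD !cImD !cReN !cImN Re_polar Im_polar /= oppr0 addr0.
move: (D1 _ s1) (D2 _ t2) (D3 _ t3); rewrite expR0 cos0 sin0 oppr0 mul0r !subr0 !mul1r !addr0.
set E := expR s => A B D.
have e0' : 0 <= e / 8 by exact: ltW.
have cE : E * cos t - 1 - s = (E - 1 - s) * cos t + (1 + s) * (cos t - 1) by ring.
have sE : E * sin t - t = (E - 1 - s) * sin t + s * sin t + (sin t - t) by ring.
have abs_cos : `|cos t| <= 1 by rewrite ler_norml cos_geN1 cos_le1.
have abs_sin : `|sin t| <= 1 by rewrite ler_norml sin_geN1 sin_le1.
have sint : `|sin t| <= 2 * `|t|.
  rewrite -[sin t](subrK t); apply: le_trans (ler_normD _ _) _.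
  rewrite mulr_natl mulr2n lerD2r; apply: le_trans D _.
  by rewrite ler_piMl//; lra.
have b1 : `|(E - 1 - s) * cos t| <= e / 8 * `|s|.
  by rewrite normrM -[leRHS]mulr1 ler_pM.
have b2 : `|(1 + s) * (cos t - 1)| <= 2 * (e / 8 * `|t|).
  rewrite normrM ler_pM// (le_trans (ler_normD _ _))// normr1; lra.
have b3 : `|(E - 1 - s) * sin t| <= e / 8 * `|s|.
  by rewrite normrM -[leRHS]mulr1 ler_pM.
have b4 : `|s * sin t| <= e / 8 * (2 * `|t|).
  by rewrite normrM ler_pM// ltW.
have := ler_normD ((E - 1 - s) * cos t) ((1 + s) * (cos t - 1)).
have := ler_normD ((E - 1 - s) * sin t + s * sin t) (sin t - t).
have := ler_normD ((E - 1 - s) * sin t) (s * sin t).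
rewrite -cE -sE.
have := normr_ge0 s; have := normr_ge0 t; nra.
Qed.

Lemma polar_first_order (s t e : R) : 0 < e -> exists2 d : R, 0 < d & forall s' t',
  `|s' - s| < d -> `|t' - t| < d ->
  normc (polar s' t' - polar s t - polar s t * ((s' - s) +i* (t' - t)))
    <= e * (`|s' - s| + `|t' - t|).
Proof.
move=> e0; have ee0 : 0 < e / expR s by rewrite divr_gt0// expR_gt0.
have [d d0 dP] := polar_first_order0 ee0.
exists d => // s' t' sd td.
have -> : polar s' t' = polar s t * polar (s' - s) (t' - t).
  by rewrite -polarD ![_ + (_ - _)]addrC !subrK.
rewrite -{2}[polar s t]mulr1 -!mulrBr Normc.normcM normc_polar.
rewrite -ler_pdivlMl ?expR_gt0// mulrA [_^-1 * e]mulrC.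
exact: dP.
Qed.

(** [D] is the complex derivative of [H] at [w]. *)
Definition first_order (H : C -> C) (w D : C) : Prop :=
  forall e : R, 0 < e -> exists2 d : R, 0 < d & forall w', normc (w' - w) < d ->
    normc (H w' - H w - D * (w' - w)) <= e * normc (w' - w).

Lemma normc_complex (x y : R) : normc (x +i* y) <= `|x| + `|y|.
Proof. exact: normc_le_ReIm. Qed.

Lemma first_order_polar H s t D : first_order H (polar s t) D ->
  forall e : R, 0 < e -> exists2 d : R, 0 < d & forall s' t',
  `|s' - s| < d -> `|t' - t| < d ->
  normc (H (polar s' t') - H (polar s t) - D * polar s t * ((s' - s) +i* (t' - t)))
    <= e * (`|s' - s| + `|t' - t|).
Proof.
move=> HD e e0.
pose K := expR s + 1.
have K0 : 0 < K by rewrite addr_gt0// expR_gt0.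
pose N := normc D + 1.
have N0 : 0 < N by rewrite ltr_wpDl// normc_ge0.
have e2 : 0 < e / 2 by rewrite divr_gt0.
have [d1 d10 H1] := HD (e / 2 / K) (divr_gt0 e2 K0).
have e3 : 0 < Num.min 1 (e / 2 / N) by rewrite lt_min ltr01 divr_gt0.
have [d2 d20 H2] := polar_first_order s t e3.
exists (Num.min d2 (d1 / (2 * K))); first by rewrite lt_min d20 divr_gt0// mulr_gt0.
move=> s' t'; rewrite !lt_min => /andP[sd2 sd1] /andP[td2 td1].
have := H2 _ _ sd2 td2.
set w := polar s t; set w' := polar s' t'; set z := _ +i* _; set k := `|_| + `|_|.
move=> P.
have k0 : 0 <= k by rewrite addr_ge0.
have zk : normc z <= k by exact: normc_complex.
have P1 : normc (w' - w - w * z) <= k.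
  by apply: le_trans P _; rewrite -[leRHS]mul1r ler_wpM2r// ge_min lexx.
have P2 : normc (w' - w - w * z) <= e / 2 / N * k.
  by apply: le_trans P _; rewrite ler_wpM2r// ge_min lexx orbT.
have wk : normc (w' - w) <= K * k.
  rewrite -[w' - w](subrK (w * z)); apply: le_trans (le_normcD _ _) _.
  rewrite Normc.normcM normc_polar /K mulrDl mul1r addrC lerD//.
  by rewrite ler_wpM2l// expR_ge0.
have wd : normc (w' - w) < d1.
  apply: le_lt_trans wk _.
  rewrite mulrC -ltr_pdivlMr//.
  have -> : d1 / K = d1 / (2 * K) + d1 / (2 * K) by field; rewrite gt_eqF.
  exact: ltrD.
have -> : H w' - H w - D * w * z = (H w' - H w - D * (w' - w)) + D * (w' - w - w * z) by ring.
apply: le_trans (le_normcD _ _) _; rewrite [e]splitr mulrDl; apply: lerD.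
  apply: le_trans (H1 _ wd) _.
  have eK : 0 <= e / 2 / K by rewrite ltW// divr_gt0.
  by apply: le_trans (ler_wpM2l eK wk) _; rewrite mulrA divfK// gt_eqF.
rewrite Normc.normcM.
have DN : normc D <= N by rewrite lerDl.
apply: le_trans (ler_pM (normc_ge0 _) (normc_ge0 _) DN P2) _.
by rewrite mulrA [N * _]mulrC divfK// gt_eqF.
Qed.

(** The Cauchy-Riemann equations in logarithmic polar coordinates: they say that
    the real and the imaginary part of [H (ds + i dt)] are closed forms. *)
Lemma total_diff_polar H s t D : first_order H (polar s t) D ->
  let A := D * polar s t in
  total_diff (fun s t => Re (H (polar s t))) s t (Re A) (- Im A) /\
  total_diff (fun s t => Im (H (polar s t))) s t (Im A) (Re A).
Proof.
move=> HD A; split=> e e0; have [d d0 dP] := first_order_polar HD e0;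
  exists d => // s' t' sd td; apply: le_trans (dP _ _ sd td).
- apply: le_trans (Re_le_normc _).
  rewrite -/A !cReD !cReN [Re (A * _)]cReM /=.
  by rewrite mulNr.
- apply: le_trans (Im_le_normc _).
  rewrite -/A !cImD !cImN [Im (A * _)]cImM /=.
  by rewrite [Re A * _ + _]addrC.
Qed.

Lemma polar_2pi s : polar s (2 * pi) = polar s 0.
Proof.
by rewrite /polar /cis mulr_natl cos2pi sin2pi cos0 sin0.
Qed.

Lemma total_diffN (P : R -> R -> R) x y p q : total_diff P x y p q ->
  total_diff (fun s t => - P s t) x y (- p) (- q).
Proof.
move=> dP e e0; have [d d0 Pd] := dP e e0; exists d => // x' y' xd yd.
by rewrite !mulNr -!opprD normrN; exact: Pd.
Qed.

(** The closed forms of [total_diff_polar] are integrated around the rectangle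
    [[a, b] x [0, 2 pi]].  By periodicity the two horizontal sides cancel, and the
    vertical sides are the means over the circles of radii [expR a] and
    [expR b]. *)
Lemma circle_mean_const H (a b : R) : a <= b ->
  (forall s t, a <= s <= b -> exists D, first_order H (polar s t) D) ->
  circle_int (fun z => H ((expR a)%:C * z)) = circle_int (fun z => H ((expR b)%:C * z)).
Proof.
move=> ab HD.
have pi20 : 0 <= 2 * pi :> R by rewrite mulr_ge0// pi_ge0.
have HD' s t : a <= s <= b -> 0 <= t <= 2 * pi ->
    exists A : C,
  total_diff (fun s t => Re (H (polar s t))) s t (Re A) (- Im A) /\
  total_diff (fun s t => Im (H (polar s t))) s t (Im A) (Re A).
  move=> sab _; have [D /total_diff_polar h] := HD s t sab.
  by exists (D * polar s t).
have HIm s t : a <= s <= b -> 0 <= t <= 2 * pi -> exists p q r,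
    total_diff (fun s t => Im (H (polar s t))) s t p q /\
    total_diff (fun s t => Re (H (polar s t))) s t q r.
  move=> sab tab; have [A [h1 h2]] := HD' s t sab tab.
  by exists (Im A), (Re A), (- Im A).
have HRe s t : a <= s <= b -> 0 <= t <= 2 * pi -> exists p q r,
    total_diff (fun s t => - Re (H (polar s t))) s t p q /\
    total_diff (fun s t => Im (H (polar s t))) s t q r.
  move=> sab tab; have [A [h1 h2]] := HD' s t sab tab.
  exists (- Re A), (Im A), (Re A); split => //.
  by have := total_diffN h1; rewrite opprK.
have eqRe : \int[mu]_(t in `[0, 2 * pi]) Re (H (polar a t)) =
            \int[mu]_(t in `[0, 2 * pi]) Re (H (polar b t)).
  have := closed_form_rectangle ab pi20 HIm.
  have -> : \int[mu]_(x in `[a, b]) Im (H (polar x (2 * pi))) =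
            \int[mu]_(x in `[a, b]) Im (H (polar x 0)).
    by apply: eq_Rintegral => s _; rewrite polar_2pi.
  by move=> /addrI ->.
have eqIm : \int[mu]_(t in `[0, 2 * pi]) Im (H (polar a t)) =
            \int[mu]_(t in `[0, 2 * pi]) Im (H (polar b t)).
  have := closed_form_rectangle ab pi20 HRe.
  have -> : \int[mu]_(x in `[a, b]) - Re (H (polar x (2 * pi))) =
            \int[mu]_(x in `[a, b]) - Re (H (polar x 0)).
    by apply: eq_Rintegral => s _; rewrite polar_2pi.
  by move=> /addrI ->.
by apply: complex_eqP; rewrite /=; [rewrite -/(polar _ _) eqRe|rewrite eqIm].
Qed.

Definition continuous_at (H : C -> C) (w : C) : Prop :=
  forall e : R, 0 < e -> exists2 d : R, 0 < d & forall w', normc (w' - w) < d ->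
    normc (H w' - H w) < e.

Lemma ccvg_continuous H w (u : nat -> C) : continuous_at H w -> ccvg u w ->
  ccvg (fun k => H (u k)) (H w).
Proof.
move=> cH uw e e0; have [d d0 Hd] := cH e e0.
by apply: filterS (uw d d0) => k /Hd.
Qed.

Lemma normc_circle (r t : R) : 0 <= r -> normc (r%:C * cis t) = r.
Proof. by move=> r0; rewrite Normc.normcM normc_cis normc_real mulr1 ger0_norm. Qed.

Lemma circle_measurable_continuous H (r : R) :
  (forall t, continuous_at H (r%:C * cis t)) ->
  circle_measurable (fun z => H (r%:C * z)).
Proof.
move=> cH.
have key t e : 0 < e -> \forall s \near t, normc (H (r%:C * cis s) - H (r%:C * cis t)) < e.
  move=> e0; have [d d0 Hd] := cH t e e0.
  have d1 : 0 < d / (2 * (`|r| + 1)) by rewrite divr_gt0// mulr_gt0// ltr_wpDl.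
  have /cvgrPdist_lt/(_ _ d1) cc := @continuous_cos R t.
  have /cvgrPdist_lt/(_ _ d1) cs := @continuous_sin R t.
  apply: filterS2 cc cs => s cc cs; apply: Hd.
  rewrite -mulrBr Normc.normcM normc_real.
  have : normc (cis s - cis t) < d / (`|r| + 1).
    apply: le_lt_trans (normc_le_ReIm _) _.
    rewrite cReD cImD cReN cImN /= distrC [X in _ + X]distrC.
    have -> : d / (`|r| + 1) = d / (2 * (`|r| + 1)) + d / (2 * (`|r| + 1)).
      by field; rewrite gt_eqF// ltr_wpDl.
    exact: ltrD.
  rewrite ltr_pdivlMr ?ltr_wpDl//; apply: le_lt_trans.
  by rewrite mulrC ler_wpM2l ?normc_ge0// lerDl.
apply: circle_measurable_cts => t; apply/cvgrPdist_lt => e e0;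
  apply: filterS (key t e e0) => s; apply: le_lt_trans; rewrite distrC.
- by rewrite -cReN -cReD; exact: Re_le_normc.
- by rewrite -cImN -cImD; exact: Im_le_normc.
Qed.

(** The mean over the circle of radius [r] depends continuously on [r]; only the
    case of a constant sequence of means is used. *)
Lemma circle_mean_limit H (M : R) (r_ : nat -> R) (r : R) (c : C) :
  (forall w, normc w < 1 -> normc (H w) <= M) ->
  (forall w, normc w < 1 -> continuous_at H w) ->
  (forall k, 0 <= r_ k < 1) -> 0 <= r < 1 -> r_ @ \oo --> r ->
  (forall k, circle_int (fun z => H ((r_ k)%:C * z)) = c) ->
  circle_int (fun z => H (r%:C * z)) = c.
Proof.
move=> HM cH r_01 r01 rr Jc.
have lt1 (x : R) t : 0 <= x < 1 -> normc (x%:C * cis t) < 1.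
  by move=> /andP[x0 x1]; rewrite normc_circle.
have mH (x : R) : 0 <= x < 1 -> circle_measurable (fun z => H (x%:C * z)).
  by move=> x01; apply: circle_measurable_continuous => t; exact/cH/lt1.
have := @circle_int_dct R (fun k z => H ((r_ k)%:C * z)) (fun z => H (r%:C * z))
  (fun=> 1) M _ (mH _ r01) _ _ _.
rewrite (@circle_int_eq _ (fun z => H (r%:C * z) * 1) (fun z => H (r%:C * z))); last first.
  by move=> t _; rewrite mulr1.
move=> H1; have {}H1 := H1 _ _ _ _; apply: ccvg_unique (H1 _ _ _ _) _.
- by move=> k; exact/mH/r_01.
- exact: L2_integrable (L2_cst 1).
- by move=> k t _; exact/HM/lt1/r_01.
- apply: ae_circle_all => t _; apply: ccvg_continuous; first exact/cH/lt1.
  move=> e e0; move/cvgrPdist_lt : rr => /(_ _ e0); apply: filterS => k.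
  by rewrite -mulrBl Normc.normcM normc_cis mulr1 -rmorphB normc_real distrC.
- rewrite (_ : (fun k => _) = fun=> c); first exact: ccvg_cst.
  apply/funext => k; rewrite -(Jc k); apply: circle_int_eq => t _; exact: mulr1.
Qed.

(** By [circle_mean_const] the mean over the circle of radius [r] is constant on
    [(0, al)] and on [(al, 1)].  It is also continuous on [[0, 1)], so it is
    constant, and its value at 0 is [H 0].  The exceptional circle of radius [al]
    leaves room for a removable singularity: [H] is only required to be
    continuous there. *)
Lemma circle_mean_value H (M al rho : R) :
  (forall w, normc w < 1 -> normc (H w) <= M) ->
  (forall w, normc w < 1 -> continuous_at H w) ->
  (forall w, 0 < normc w < 1 -> normc w != al -> exists D, first_order H w D) ->
  0 <= al < 1 -> 0 <= rho < 1 -> circle_int (fun z => H (rho%:C * z)) = H 0.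
Proof.
move=> HM cH dH al01 rho01.
pose J (r : R) := circle_int (fun z => H (r%:C * z)).
have J0 : J 0 = H 0.
  rewrite -[RHS]circle_int_cst; apply: circle_int_eq => t _.
  by rewrite mul0r.
have Jc r1 r2 : 0 < r1 -> r1 <= r2 -> r2 < 1 -> (r2 < al) || (al < r1) -> J r1 = J r2.
  move=> r10 r12 r21 ral; have r20 := lt_le_trans r10 r12.
  have := @circle_mean_const H (ln r1) (ln r2).
  rewrite !lnK ?posrE// ler_ln ?posrE//; apply => // s t /andP[s1 s2].
  have es1 : r1 <= expR s by rewrite -[r1]lnK ?posrE// ler_expR.
  have es2 : expR s <= r2 by rewrite -[r2]lnK ?posrE// ler_expR.
  apply: dH; rewrite normc_polar ?expR_gt0 ?(le_lt_trans es2)//.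
  case/orP: ral => ral; first by rewrite lt_eqF// (le_lt_trans es2).
  by rewrite gt_eqF// (lt_le_trans ral).
have harm0 (x y : R) : (fun k => x + y * k.+1%:R^-1) @ \oo --> x.
  rewrite -[X in _ --> X]addr0; apply: cvgD; first exact: cvg_cst.
  by rewrite -(mulr0 y); apply: cvgMr; exact: cvg_harmonic.
have h01 k : 0 < (k.+1%:R^-1 : R) <= 1.
  apply/andP; split; first by rewrite invr_gt0 ltr0n.
  by rewrite -[leRHS]invr1 lef_pV2 ?posrE ?ltr0n// ler1n.
have shrink (x : R) k : 0 < x -> 0 < x * k.+1%:R^-1 <= x.
  move=> x0; have /andP[k0 k1] := h01 k; rewrite mulr_gt0//= ler_piMr//.
  exact: ltW.
(* Each of the three cases moves the radius along a sequence with constant mean: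
   down to 0, up to [al], and down to [al]. *)
have below r : 0 < r -> r < al -> J r = H 0.
  move=> r0 ral; rewrite -J0; apply/esym.
  have [al0 al1] := andP al01.
  apply: (circle_mean_limit HM cH (r_ := fun k => 0 + r * k.+1%:R^-1)) => //.
  - move=> k; rewrite add0r; have /andP[k0 k1] := shrink r k r0.
    by rewrite (ltW k0) (le_lt_trans k1)// (lt_trans ral).
  - by rewrite lexx ltr01.
  - move=> k; rewrite add0r; have /andP[k0 k1] := shrink r k r0.
    by apply: Jc; rewrite ?ral// (lt_trans ral).
have at_al : J al = H 0.
  have [al0 al1] := andP al01.
  have := al0; rewrite le_eqVlt => /orP[/eqP <-//|alp].
  have al2 : 0 < al / 2 by rewrite divr_gt0.
  apply: (circle_mean_limit HM cH (r_ := fun k => al + (- (al / 2)) * k.+1%:R^-1)) => //.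
  - by move=> k; rewrite mulNr; move: (al / 2 * _) (shrink _ k al2) => y /andP[k0 k1];
    apply/andP; split; lra.
  - by move=> k; rewrite mulNr; move: (al / 2 * _) (shrink _ k al2) => y /andP[k0 k1];
    apply: below; lra.
have above r : al < r -> r < 1 -> J r = H 0.
  move=> alr r1; rewrite -at_al; apply/esym; have [al0 al1] := andP al01.
  have ra0 : 0 < r - al by rewrite subr_gt0.
  apply: (circle_mean_limit HM cH (r_ := fun k => al + (r - al) * k.+1%:R^-1)) => //.
  - by move=> k; move: ((r - al) * _) (shrink _ k ra0) => y /andP[k0 k1]; apply/andP; split;
    lra.
  - move=> k; move: ((r - al) * _) (shrink _ k ra0) => y /andP[k0 k1]; apply: Jc => //;
    [lra|lra|].
    by rewrite ltrDl k0 orbT.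
have [rho0 rho1] := andP rho01.
have [ra|ra|->] := ltgtP rho al; last exact: at_al.
- by move: rho0; rewrite le_eqVlt => /orP[/eqP <-//|rho0]; exact: below.
- exact: above.
Qed.
End Polar.

(** * Cauchy's integral formula and polynomial approximation *)

Section Holomorphic.
Variable R : realType.
Local Notation C := R[i].
Local Notation normc := (@Normc.normc R).
Local Notation Re := (@complex.Re R).

Lemma derivable_first_order (f : C -> C) (w : C) :
  derivable (f : C^o -> C^o) w 1 -> exists D, first_order f w D.
Proof.
rewrite /derivable => /cvg_ex[/= D fD]; exists D => e e0.
have e0C : 0 < e%:C by rewrite ltcR.
move/cvgrPdist_le : fD => /(_ _ e0C) /nbhs_ballP[d /= d0 dP].
have dE : d = (Re d)%:C by apply/esym/RRe_real/gtr0_real.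
exists (Re d); first by rewrite -ltcR -dE.
move=> w' wd.
have [->|w'w] := eqVneq w' w.
  by rewrite !subrr mulr0 subr0 Normc.normc0 mulr0.
have h0 : w' - w != 0 by rewrite subr_eq0.
have := dP (w' - w); rewrite /ball/= sub0r normrN normr_normc dE ltcR => /(_ wd h0).
rewrite /GRing.scale /= mulr1 subrK normr_normc lecR => H.
have -> : f w' - f w - D * (w' - w) = - ((D - (w' - w)^-1 * (f w' - f w)) * (w' - w)).
  by rewrite mulrBl mulrAC mulVf// mul1r opprB.
by rewrite normcN Normc.normcM ler_wpM2r// normc_ge0.
Qed.

Lemma first_order_continuous (f : C -> C) w D : first_order f w D -> continuous_at f w.
Proof.
move=> fD e e0; have [d d0 dP] := fD 1 ltr01.
pose N := normc D + 1; have N0 : 0 < N + 1 by have := normc_ge0 D; rewrite /N; lra.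
exists (Num.min d (e / (N + 1))); first by rewrite lt_min d0 divr_gt0.
move=> w'; rewrite lt_min => /andP[wd we].
rewrite -[f w' - f w](subrK (D * (w' - w))); apply: le_lt_trans (le_normcD _ _) _.
apply: le_lt_trans (lerD (dP _ wd) (lexx _)) _.
rewrite Normc.normcM -mulrDl mulrC; move: we; rewrite ltr_pdivlMr//.
apply: le_lt_trans; rewrite ler_wpM2l ?normc_ge0// /N; lra.
Qed.

Lemma first_order_local (f g : C -> C) w D (r : R) : 0 < r ->
  (forall w', normc (w' - w) < r -> f w' = g w') -> first_order f w D -> first_order g w D.
Proof.
move=> r0 fg fD e e0; have [d d0 dP] := fD e e0.
exists (Num.min d r); first by rewrite lt_min d0.
move=> w'; rewrite lt_min => /andP[wd wr]; rewrite -!fg//; first exact: dP.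
by rewrite subrr Normc.normc0.
Qed.

Lemma normc_gt0 (z : C) : z != 0 -> 0 < normc z.
Proof.
move=> z0; rewrite lt_neqAle normc_ge0 andbT eq_sym.
by apply: contra z0 => /eqP /(@Normc.eq0_normc R) ->.
Qed.

Lemma derivable_inv_sub (a w : C) : w != a ->
  derivable ((fun w => (w - a)^-1) : C^o -> C^o) w 1.
Proof.
move=> wa; have wa0 : w - a != 0 by rewrite subr_eq0.
apply: (@derivableV _ _ (fun w : C^o => w - a : C^o)); [exact: wa0|].
have idD : derivable (id : C^o -> C^o) w 1 := @derivable_id _ C^o w 1.
have := @derivableB _ C^o C^o _ _ w 1 idD (@derivable_cst _ C^o C^o a w 1).
exact.
Qed.

Section DifferenceQuotient.
Variables (f : C -> C) (M : R).
Hypothesis fD : forall z : C, normc z < 1 -> derivable (f : C^o -> C^o) z 1.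
Hypothesis fM : forall z : C, normc z < 1 -> normc (f z) <= M.

(** [w] times the difference quotient of [f] at [a], extended by continuity when [D]
    is the derivative of [f] at [a].  Its mean over a circle around 0 is, up to a
    constant, the contour integral of the difference quotient. *)
Definition quotient_mul (a D w : C) : C :=
  if w == a then D * a else (f w - f a) / (w - a) * w.

Lemma quotient_mul_first_order a D w : normc w < 1 -> w != a ->
  exists D', first_order (quotient_mul a D) w D'.
Proof.
move=> w1 wa.
have wa0 : w - a != 0 by rewrite subr_eq0.
have [D' gD'] : exists D', first_order (fun w => (f w - f a) * (w - a)^-1 * w) w D'.
  apply: derivable_first_order.
  apply: (@derivableM _ _ (fun w : C^o => (f w - f a) * (w - a)^-1 : C^o) id);
    last exact: derivable_id.
  apply: (@derivableM _ _ (fun w : C^o => f w - f a : C^o) (fun w : C^o => (w - a)^-1 : C^o)).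
    exact: (@derivableB _ C^o C^o f (cst (f a)) w 1 (fD w1) (derivable_cst _ _ _)).
  exact: derivable_inv_sub.
exists D'; apply: (first_order_local (normc_gt0 wa0)) gD' => w' w'w.
rewrite /quotient_mul; case: eqP => // w'a.
by move: w'w; rewrite w'a normcB ltxx.
Qed.

Lemma quotient_mul_continuous a D : normc a < 1 -> first_order f a D ->
  continuous_at (quotient_mul a D) a.
Proof.
move=> a1 faD e e0.
pose N := normc D + 2.
have N0 : 0 < N by rewrite ltr_wpDl ?normc_ge0.
have e1 : 0 < Num.min 1 (e / 2) by rewrite lt_min ltr01 divr_gt0.
have [d d0 dP] := faD _ e1.
exists (Num.min d (e / 2 / N)); first by rewrite lt_min d0 !divr_gt0.
move=> w; rewrite lt_min => /andP[wd we]; rewrite /quotient_mul eqxx.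
case: eqVneq => [_|wa]; first by rewrite subrr Normc.normc0.
have wa0 : w - a != 0 by rewrite subr_eq0.
have [q qE] : exists q, q = (f w - f a) / (w - a) by eexists.
rewrite -qE.
have qD : normc (q - D) <= Num.min 1 (e / 2).
  have := dP _ wd.
  have -> : f w - f a - D * (w - a) = (q - D) * (w - a) by rewrite mulrBl qE divfK.
  by rewrite Normc.normcM ler_pM2r// normc_gt0.
have [qD1 qD2] : normc (q - D) <= 1 /\ normc (q - D) <= e / 2.
  by move: qD; rewrite le_min => /andP[].
have qN : normc q < N.
  rewrite -[q](subrK D); apply: le_lt_trans (le_normcD _ _) _; rewrite /N; lra.
have -> : q * w - D * a = q * (w - a) + (q - D) * a by ring.
apply: le_lt_trans (le_normcD _ _) _; rewrite !Normc.normcM.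
have h1 : normc q * normc (w - a) < e / 2.
  move: we; rewrite ltr_pdivlMr//; apply: le_lt_trans.
  by rewrite mulrC ler_wpM2l ?normc_ge0// ltW.
have h2 : normc (q - D) * normc a <= e / 2.
  by rewrite -[leRHS]mulr1 ler_pM ?normc_ge0// ltW.
lra.
Qed.

Lemma quotient_mul_bounded a D : normc a < 1 -> first_order f a D ->
  exists B, forall w, normc w < 1 -> normc (quotient_mul a D w) <= B.
Proof.
move=> a1 faD; have [d d0 dP] := faD 1 ltr01.
have M0 : 0 <= M by apply: le_trans (normc_ge0 _) (fM a1).
exists (normc D + 1 + 2 * M / d) => w w1; rewrite /quotient_mul.
have Md : 0 <= 2 * M / d by rewrite divr_ge0 ?mulr_ge0// ltW.
have D0 := normc_ge0 D.
case: eqVneq => [_|wa].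
  rewrite Normc.normcM; have := normc_ge0 a; nra.
have wa0 : w - a != 0 by rewrite subr_eq0.
rewrite Normc.normcM; set q := (f w - f a) / (w - a).
suff qB : normc q <= normc D + 1 + 2 * M / d.
  by rewrite -[leRHS]mulr1 ler_pM ?normc_ge0// ltW.
have [wd|wd] := ltP (normc (w - a)) d.
  have : normc (q - D) <= 1.
    have := dP _ wd.
    have -> : f w - f a - D * (w - a) = (q - D) * (w - a) by rewrite mulrBl /q divfK.
    by rewrite Normc.normcM ler_pM2r// normc_gt0.
  have := le_normcD (q - D) D; rewrite subrK; lra.
have : normc q <= 2 * M / d.
  rewrite /q Normc.normcM Normc.normcV ler_pM ?normc_ge0 ?invr_ge0 ?normc_ge0//.
    apply: le_trans (le_normcD _ _) _; rewrite normcN.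
    have := fM w1; have := fM a1; lra.
  by rewrite lef_pV2// posrE ?normc_gt0.
lra.
Qed.

(** The function is holomorphic off [a] and continuous and bounded everywhere, so
    [circle_mean_value] applies with the circle through [a] as the exceptional
    one; the factor [w] makes the value at 0 vanish.  This is Cauchy's integral
    formula for [f a]. *)
Lemma quotient_mul_mean a D rho : normc a < 1 -> first_order f a D -> 0 <= rho < 1 ->
  circle_int (fun z => quotient_mul a D (rho%:C * z)) = 0.
Proof.
move=> a1 faD rho01.
have [B BP] := quotient_mul_bounded a1 faD.
have -> : 0 = quotient_mul a D 0.
  by rewrite /quotient_mul; case: eqVneq => [<-|_]; rewrite mulr0.
apply: (circle_mean_value BP (al := normc a)) => //.
- move=> w w1; have [->|wa] := eqVneq w a; first exact: quotient_mul_continuous.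
  have [D' h] := quotient_mul_first_order D w1 wa; exact: first_order_continuous h.
- move=> w /andP[w0 w1] wa; apply: quotient_mul_first_order => //.
  by apply: contra wa => /eqP ->.
- by rewrite normc_ge0.
Qed.

End DifferenceQuotient.
End Holomorphic.

Section Cauchy.
Variable R : realType.
Local Notation C := R[i].
Local Notation mu := (@lebesgue_measure R).
Local Notation normc := (@Normc.normc R).
Local Notation angles := (@angles R).

Lemma circle_int_bound (f : C -> C) (M : R) : circle_integrable f ->
  (forall t, normc (f (cis t)) <= M) -> normc (circle_int f) <= 2 * M.
Proof.
move=> [fr fi] fM.
have pi20 : 0 < 2 * pi :> R by rewrite mulr_gt0// pi_gt0.
have key (g : R -> R) : mu.-integrable angles (EFin \o g) -> (forall t, `|g t| <= M) ->
    `|(2 * pi)^-1 * \int[mu]_(t in angles) g t| <= M.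
  move=> gi gM; rewrite normrM gtr0_norm ?invr_gt0// ler_pdivrMl//.
  have := @le_normr_Rintegral_itv R g 0 (2 * pi) M (ltW pi20) gi (fun t _ => gM t).
  by rewrite subr0 [M * _]mulrC.
apply: le_trans (normc_le_ReIm _) _; rewrite mulr_natl mulr2n; apply: lerD.
- by apply: key => // t; apply: le_trans (fM t); exact: Re_le_normc.
- by apply: key => // t; apply: le_trans (fM t); exact: Im_le_normc.
Qed.

(** The mean value property of [z ^+ n], read off at radius [1 / 2]. *)
Lemma circle_int_exprn (n : nat) : (0 < n)%N -> circle_int (fun z : C => z ^+ n) = 0.
Proof.
move=> n0.
have H1 : circle_int (fun z : C => ((2^-1 : R)%:C * z) ^+ n) = 0 ^+ n.
  apply: (@circle_mean_value R (fun z => z ^+ n) 1 0).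
  - by move=> w w1; rewrite normcX exprn_ile1 ?normc_ge0// ltW.
  - move=> w w1; have [|D] := @derivable_first_order R (fun z => z ^+ n) w.
      exact: exprn_derivable.
    exact: first_order_continuous.
  - move=> w _ _; apply: derivable_first_order; exact: exprn_derivable.
  - by rewrite lexx ltr01.
  - by rewrite invr_ge0 ler0n invf_lt1// ltr1n.
move: H1; rewrite (@circle_int_eq R _ (fun z => ((2^-1 : R)%:C) ^+ n * z ^+ n)); last first.
  by move=> t _; rewrite exprMn.
rewrite circle_intZ; last first.
  exact: (L2_integrable (L2_exprz R n)).
rewrite expr0n gtn_eqF// => /eqP; rewrite mulf_eq0 expf_eq0 n0/= => /orP[|/eqP//].
by rewrite eq_complex/= invr_eq0 pnatr_eq0.
Qed.

Lemma circle_int_exprz (n : int) : n != 0 -> circle_int (fun z : C => z ^ n) = 0.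
Proof.
case: n => n n0; first by apply: circle_int_exprn; rewrite lt0n.
rewrite (@circle_int_eq R _ (fun z => (z ^+ n.+1)^*)); last first.
  by move=> t _; rewrite NegzE -exprnN rmorphXn/= conj_cis exprVn.
rewrite circle_int_conj; last exact: (L2_integrable (L2_exprz R n.+1)).
by rewrite circle_int_exprn// conjC0.
Qed.

Lemma geom_sum (x : C) N : x != 1 -> \sum_(n < N) x ^+ n = (1 - x ^+ N) / (1 - x).
Proof.
move=> x1; have x10 : 1 - x != 0 by rewrite subr_eq0 eq_sym.
by apply: (mulIf x10); rewrite divfK// -[1 - x ^+ N]opprB subrX1 -mulNr opprB mulrC.
Qed.

Lemma normc_1sub (x : C) : 1 - normc x <= normc (1 - x).
Proof.
have := le_normcD (1 - x) x; rewrite subrK Normc.normc1; lra.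
Qed.

Lemma geom_bound (x : C) N : normc x < 1 ->
  normc (\sum_(n < N) x ^+ n) <= 2 / (1 - normc x).
Proof.
move=> x1; rewrite geom_sum; last by apply: contraTneq x1 => ->; rewrite Normc.normc1 ltxx.
rewrite Normc.normcM Normc.normcV; apply: ler_pM; rewrite ?normc_ge0 ?invr_ge0 ?normc_ge0//.
  apply: le_trans (le_normcD _ _) _; rewrite Normc.normc1 normcN normcX.
  have : normc x ^+ N <= 1 by rewrite exprn_ile1 ?normc_ge0 ?ltW.
  lra.
have := normc_1sub x => h.
by rewrite lef_pV2// posrE ?subr_gt0// (lt_le_trans _ h)// subr_gt0.
Qed.

Lemma geom_ccvg (x : C) : normc x < 1 ->
  ccvg (fun N => \sum_(n < N) x ^+ n) ((1 - x)^-1).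
Proof.
move=> x1 e e0.
have x10 : 0 < 1 - normc x by rewrite subr_gt0.
have nx1 : x != 1 by apply: contraTneq x1 => ->; rewrite Normc.normc1 ltxx.
have h := normc_1sub x.
have n10 : 0 < normc (1 - x) by exact: lt_le_trans h.
have : (fun N => normc x ^+ N) @ \oo --> (0 : R).
  by apply: cvg_expr; rewrite ger0_norm ?normc_ge0.
have ee : 0 < e * normc (1 - x) by rewrite mulr_gt0.
move/cvgrPdist_lt => /(_ _ ee); apply: filterS => N; rewrite sub0r normrN.
rewrite ger0_norm ?exprn_ge0 ?normc_ge0// => xN.
rewrite geom_sum//.
have -> : (1 - x ^+ N) / (1 - x) - (1 - x)^-1 = - (x ^+ N / (1 - x)) by ring.
by rewrite normcN Normc.normcM normcX Normc.normcV ltr_pdivrMr.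
Qed.

End Cauchy.

Section BoundedHolomorphic.
Variable R : realType.
Local Notation C := R[i].
Local Notation normc := (@Normc.normc R).

Lemma circle_measurable_sum (F : nat -> C -> C) N :
  (forall n, circle_measurable (F n)) -> circle_measurable (fun z => \sum_(n < N) F n z).
Proof.
move=> mF; elim: N => [|N IH].
  by apply: circle_measurable_eq (circle_measurable_cst (0 : C)) => t _; rewrite big_ord0.
apply: circle_measurable_eq (circle_measurableD IH (mF N)) => t _.
by rewrite big_ord_recr.
Qed.

Lemma exprVz (z : C) (n : nat) : z^-1 ^+ n = z ^ (- n%:Z).
Proof. by rewrite exprVn exprnN. Qed.

Lemma L2_exprV (n : nat) : L2 (fun z : C => z^-1 ^+ n).
Proof. by apply: L2_eq (L2_exprz R (- n%:Z)) => t _; rewrite exprVz. Qed.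

Lemma circle_int_exprV (n : nat) : circle_int (fun z : C => z^-1 ^+ n) = (n == 0%N)%:R.
Proof.
case: n => [|n].
  rewrite -[RHS]circle_int_cst; apply: circle_int_eq => t _; by rewrite expr0.
rewrite -[RHS](@circle_int_exprz R (- n.+1%:Z))//.
by apply: circle_int_eq => t _; rewrite exprVz.
Qed.

Lemma circle_measurable_kernel (lam : C) : normc lam < 1 ->
  circle_measurable (fun z : C => z / (z - lam)).
Proof.
move=> l1.
have : circle_measurable (fun z : C => (1 : R)%:C * z / ((1 : R)%:C * z - lam)).
  apply: (@circle_measurable_continuous R (fun w => w / (w - lam)) 1) => t; rewrite mul1r.
  have cl : cis t != lam by apply: contraTneq l1 => <-; rewrite normc_cis ltxx.
  have [D] := @derivable_first_order R (fun w => w / (w - lam)) (cis t)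
    (@derivableM _ C^o id (fun w => (w - lam)^-1) _ _ (@derivable_id _ _ _ _) (derivable_inv_sub cl)).
  exact: first_order_continuous.
by apply: circle_measurable_eq => t _; rewrite mul1r.
Qed.

Variables (f : C -> C) (M : R).
Hypothesis fD : forall z : C, normc z < 1 -> derivable (f : C^o -> C^o) z 1.
Hypothesis fM : forall z : C, normc z < 1 -> normc (f z) <= M.

Lemma holomorphic_continuous w : normc w < 1 -> continuous_at f w.
Proof.
by move=> /fD /derivable_first_order[D]; exact: first_order_continuous.
Qed.

Lemma bounded_circle_dilate rho : 0 <= rho < 1 -> bounded_circle (fun z => f (rho%:C * z)).
Proof.
move=> /andP[r0 r1]; apply: (@bounded_circle_pt R _ M).
  apply: circle_measurable_continuous => t; apply: holomorphic_continuous.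
  by rewrite normc_circle.
by move=> t; apply: fM; rewrite normc_circle.
Qed.

Lemma holomorphic_mean rho : 0 <= rho < 1 -> circle_int (fun z => f (rho%:C * z)) = f 0.
Proof.
move=> r01; apply: (circle_mean_value fM (al := 0)) => //.
- exact: holomorphic_continuous.
- by move=> w /andP[_ w1] _; exact/derivable_first_order/fD.
- by rewrite lexx ltr01.
Qed.

(** [rho ^+ n] times the [n]-th Taylor coefficient of [f]. *)
Definition circle_coef (rho : R) (n : nat) : C :=
  circle_int (fun z => f (rho%:C * z) * z^-1 ^+ n).

(** In [quotient_mul_mean] at the point [rho * lam] the Cauchy kernel, on the
    circle of radius [rho], is [z / (z - lam)].  It is the bounded limit of the
    partial sums of the geometric series in [lam / z], and integrating these
    against [f (rho * z) - f (rho * lam)] produces the partial sums of the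
    Taylor series minus [f (rho * lam)]. *)
Lemma cauchy_series rho lam : 0 <= rho < 1 -> normc lam < 1 ->
  ccvg (fun N => \sum_(n < N) lam ^+ n * circle_coef rho n) (f (rho%:C * lam)).
Proof.
move=> r01 l1; have [r0 r1] := andP r01.
set a := rho%:C * lam.
have a1 : normc a < 1.
  rewrite Normc.normcM normc_real ger0_norm//.
  by apply: le_lt_trans l1; rewrite ler_piMl ?normc_ge0// ltW.
have [D aD] := derivable_first_order (fD a1).
pose g z := f (rho%:C * z) - f a.
have fL : L2 (fun z => f (rho%:C * z)) by exact/bounded_L2/bounded_circle_dilate.
have gL : L2 g.
  apply: L2_eq (L2_lin (-1) (L2_cst (f a)) fL) => t _.
  by rewrite mulN1r addrC.
pose h_ N (z : C) := \sum_(n < N) (lam * z^-1) ^+ n.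
have normx t : normc (lam * (cis t)^-1) = normc lam.
  by rewrite Normc.normcM Normc.normcV normc_cis invr1 mulr1.
have hk : ccvg (fun N => circle_int (fun z => h_ N z * g z))
    (circle_int (fun z => z / (z - lam) * g z)).
  apply: (circle_int_dct (M := 2 / (1 - normc lam))).
  - move=> N; apply: (@circle_measurable_sum (fun n z => (lam * z^-1) ^+ n) N) => n.
    apply: circle_measurable_eq (circle_measurableM (circle_measurable_cst (lam ^+ n))
      (L2_circle_measurable (L2_exprV n))) => t _.
    by rewrite exprMn.
  - exact: circle_measurable_kernel.
  - exact: L2_integrable.
  - by move=> N t _; rewrite -(normx t); apply: geom_bound; rewrite normx.
  - apply: ae_circle_all => t _.
    have -> : cis t / (cis t - lam) = (1 - lam * (cis t)^-1)^-1.
      have c0 := cis_neq0 t.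
      have cl : cis t - lam != 0.
        by rewrite subr_eq0; apply: contraTneq l1 => <-; rewrite normc_cis ltxx.
      by field; rewrite c0 cl.
    by apply: geom_ccvg; rewrite normx.
have lim0 : circle_int (fun z => z / (z - lam) * g z) = 0.
  have := quotient_mul_mean fD fM a1 aD r01.
  have [r00|rn0] := eqVneq rho 0.
    move=> _; rewrite -[RHS](circle_int_cst (0 : C)); apply: circle_int_eq => t _.
    by rewrite /g /a r00 !mul0r subrr mulr0.
  move=> <-; apply: circle_int_eq => t _.
  have rC0 : rho%:C != 0 :> C by rewrite eq_complex/= negb_and rn0.
  have c0 := cis_neq0 t.
  have cl : cis t - lam != 0.
    by rewrite subr_eq0; apply: contraTneq l1 => <-; rewrite normc_cis ltxx.
  rewrite /quotient_mul /g /a (inj_eq (mulfI rC0)) -subr_eq0 (negbTE cl) -mulrBr.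
  by field; rewrite rC0 cl.
have sumE N : (0 < N)%N -> circle_int (fun z => h_ N z * g z) =
    \sum_(n < N) lam ^+ n * circle_coef rho n - f a.
  move=> N0.
  have term n : circle_int (fun z => (lam * z^-1) ^+ n * g z) =
      lam ^+ n * (circle_coef rho n - f a * (n == 0%N)%:R).
    rewrite (@circle_int_eq R _ (fun z => lam ^+ n *
      ((- f a) * (z^-1 ^+ n) + f (rho%:C * z) * z^-1 ^+ n))); last first.
      by move=> t _; rewrite exprMn /g; ring.
    have I1 := L2_integrable (L2_exprV n).
    have I2 := L2M_integrable fL (L2_exprV n).
    rewrite circle_intZ; last exact: circle_integrable_lin.
    by rewrite circle_int_lin// circle_int_exprV mulNr addrC.
  rewrite (@circle_int_eq R _ (fun z => \sum_(n < N) (lam * z^-1) ^+ n * g z)); last first.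
    by move=> t _; rewrite /h_ mulr_suml.
  rewrite (@circle_int_sum R N (fun n z => (lam * z^-1) ^+ n * g z)); last first.
    move=> n; apply: circle_integrable_eq (circle_integrableZ (lam ^+ n)
      (L2M_integrable (L2_exprV n) gL)) => t _.
    by rewrite exprMn mulrA.
  under eq_bigr => n _ do rewrite term mulrBr.
  rewrite big_split/=; congr (_ + _); case: N N0 => // N _.
  rewrite big_ord_recl /= expr0 mul1r mulr1 big1 ?addr0// => n _.
  by rewrite mulr0 mulr0 oppr0.
move=> e e0; move: (hk e e0); rewrite lim0 => H.
have H0 : \forall N \near \oo, (0 < N)%N by exists 1%N.
by apply: filterS2 H H0 => N + N0; rewrite sumE// subr0.
Qed.

Lemma circle_coef_bound rho n : 0 <= rho < 1 -> normc (circle_coef rho n) <= 2 * M.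
Proof.
move=> r01; have [r0 r1] := andP r01; apply: circle_int_bound.
  exact: L2M_integrable (bounded_L2 (bounded_circle_dilate r01)) (L2_exprV n).
move=> t; rewrite Normc.normcM normcX Normc.normcV normc_cis invr1 expr1n mulr1.
by apply: fM; rewrite normc_circle.
Qed.

(** On the unit circle [f (rho * z)] is a bounded limit of polynomials, by
    [cauchy_series] on an intermediate circle of radius [s], where the ratio
    [q = rho / s < 1] makes the partial sums uniformly bounded.  Each polynomial
    integrates to 0 against [g]. *)
Lemma circle_int_dilate_orth rho (g : C -> C) : 0 <= rho < 1 -> L2 g ->
  (forall n : nat, circle_int (fun z => z ^+ n * g z) = 0) ->
  circle_int (fun z => f (rho%:C * z) * g z) = 0.
Proof.
move=> r01 gL gn; have [r0 r1] := andP r01.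
(* Any radius between [rho] and 1 would do. *)
pose s := (1 + rho) / 2.
have [s0 s1 rs] : [/\ 0 < s, s < 1 & rho < s] by split; rewrite /s; lra.
have s01 : 0 <= s < 1 by rewrite ltW.
pose q := rho / s.
have [q0 q1] : 0 <= q /\ q < 1.
  by split; [rewrite divr_ge0// ltW|rewrite /q ltr_pdivrMr// mul1r].
have M0 : 0 <= M by apply: le_trans (normc_ge0 _) (@fM 0 _); rewrite Normc.normc0.
pose P N (z : C) := \sum_(n < N) (q%:C * z) ^+ n * circle_coef s n.
have mPn n : circle_measurable (fun z => (q%:C * z) ^+ n * circle_coef s n).
  apply: circle_measurable_eq (circle_measurableM (circle_measurable_exprz R n)
    (circle_measurable_cst (q%:C ^+ n * circle_coef s n))) => t _.
  by rewrite exprMn /exprz; ring.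
have PB N t : normc (P N (cis t)) <= 2 * M / (1 - q).
  have PN : normc (P N (cis t)) <= \sum_(n < N) q ^+ n * (2 * M).
    rewrite /P; elim: N => [|N IH]; first by rewrite !big_ord0 Normc.normc0.
    rewrite !big_ord_recr /=; apply: le_trans (le_normcD _ _) (lerD IH _).
    rewrite Normc.normcM normcX normc_circle//.
    by rewrite ler_wpM2l ?exprn_ge0// circle_coef_bound.
  apply: le_trans PN _; rewrite -mulr_suml mulrC ler_wpM2l ?mulr_ge0//.
  have q10 : 0 < 1 - q by rewrite subr_gt0.
  rewrite -[leRHS]mul1r ler_pdivlMr// mulrC -[1 - q]opprB mulNr -subrX1 opprB.
  by rewrite lerBlDr lerDl exprn_ge0.
have PP : ccvg (fun N => circle_int (fun z => P N z * g z))
    (circle_int (fun z => f (rho%:C * z) * g z)).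
  apply: (circle_int_dct (M := 2 * M / (1 - q))).
  - by move=> N;
    exact: (@circle_measurable_sum (fun n z => (q%:C * z) ^+ n * circle_coef s n) N mPn).
  - by case: (bounded_circle_dilate r01).
  - exact: L2_integrable.
  - by move=> N t _; exact: PB.
  - apply: ae_circle_all => t _.
    have := @cauchy_series s (q%:C * cis t) s01.
    rewrite normc_circle// mulrA -rmorphM/= [s * q]mulrC divfK ?gt_eqF//.
    exact.
apply: ccvg_unique PP _; rewrite (_ : (fun N => _) = fun=> 0); first exact: ccvg_cst.
apply/funext => N.
rewrite (@circle_int_eq R _ (fun z => \sum_(n < N) (q%:C ^+ n * circle_coef s n) *
    (z ^+ n * g z))); last first.
  move=> t _; rewrite /P mulr_suml; apply: eq_bigr => n _; rewrite exprMn; ring.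
have I n : circle_integrable (fun z => z ^+ n * g z).
  exact: (L2M_integrable (L2_exprz R n) gL).
rewrite (@circle_int_sum R N (fun n z => q%:C ^+ n * circle_coef s n * (z ^+ n * g z))).
  by rewrite big1// => n _; rewrite circle_intZ// gn mulr0.
by move=> n; exact: circle_integrableZ.
Qed.

End BoundedHolomorphic.

(** * Hardy space and inner functions *)

Section Inner.
Variable R : realType.
Local Notation C := R[i].
Local Notation mu := (@lebesgue_measure R).
Local Notation normc := (@Normc.normc R).
Local Notation Re := (@complex.Re R).
Local Notation angles := (@angles R).

Lemma L2Z (f : C -> C) : L2 f -> L2 (fun z => z * f z).
Proof. exact: (L2M_bounded (bounded_exprz R 1)). Qed.

Lemma L2V (f : C -> C) : L2 f -> L2 (fun z => f z / z).
Proof.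
move=> fL; apply: L2_eq (L2M_bounded (bounded_exprz R (-1)) fL) => t _.
by rewrite mulrC.
Qed.

Lemma conj_cisX (t : R) (n : int) : ((cis t) ^ n)^* = (cis t) ^ (- n).
Proof. by rewrite (conj_exprz (cis t) n) conj_cis exprz_inv. Qed.

Lemma H2_L2 (f : C -> C) : H2 f -> L2 f. Proof. by case. Qed.

Lemma fourier_shift (f : C -> C) (m n : int) :
  fourier (fun z => z ^ m * f z) n = fourier f (n - m).
Proof.
apply: circle_int_eq => t _; rewrite !conj_cisX opprB.
by rewrite mulrAC -expfzDr ?cis_neq0// mulrC.
Qed.

Lemma fourierE (f : C -> C) (n : int) : fourier f n = circle_int (fun z => z ^ (- n) * f z).
Proof. by apply: circle_int_eq => t _; rewrite conj_cisX mulrC. Qed.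

Lemma fourier_lin (a : C) (f g : C -> C) n : L2 f -> L2 g ->
  fourier (fun z => a * f z + g z) n = a * fourier f n + fourier g n.
Proof. by move=> fL gL; apply: dot_linl => //; exact: L2_exprz. Qed.

Lemma fourier_cst (c : C) (n : int) : n != 0 -> fourier (fun=> c) n = 0.
Proof.
move=> n0; rewrite fourierE.
rewrite (@circle_int_eq R _ (fun z => c * z ^ (- n))); last by move=> t _; rewrite mulrC.
rewrite circle_intZ; last exact: (L2_integrable (L2_exprz R _)).
by rewrite circle_int_exprz ?mulr0// oppr_eq0.
Qed.

Lemma fourier0 (f : C -> C) : fourier f 0 = circle_int f.
Proof. by rewrite fourierE; apply: circle_int_eq => t _; rewrite oppr0 expr0z mul1r. Qed.

Lemma H2_lin (a : C) (f g : C -> C) : H2 f -> H2 g -> H2 (fun z => a * f z + g z).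
Proof.
move=> [fL f0] [gL g0]; split; first exact: L2_lin.
by move=> n n0; rewrite fourier_lin// f0// g0// mulr0 addr0.
Qed.

Lemma H2_cst (c : C) : H2 (fun=> c).
Proof. by split; [exact: L2_cst|move=> n n0; rewrite fourier_cst// lt_eqF]. Qed.

Lemma H2_shift (f : C -> C) : H2 f -> H2 (fun z => z * f z).
Proof.
move=> [fL f0]; split; first exact: L2Z.
by move=> n n0; rewrite (fourier_shift f 1) f0//; lia.
Qed.

Lemma H2_exprn_int (f : C -> C) (n : nat) : H2 f -> (0 < n)%N ->
  circle_int (fun z => z ^+ n * f z) = 0.
Proof.
move=> [fL f0] n0; have := f0 (- n%:Z); rewrite fourierE opprK; apply.
by rewrite oppr_lt0.
Qed.

Lemma H2_eq (f g : C -> C) : (forall z, f z = g z) -> H2 f -> H2 g.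
Proof. by move=> /funext ->. Qed.

(** The backward shift, which turns out to be the adjoint of the compressed
    shift; [circle_int f] is the zeroth Fourier coefficient, standing for [f(0)]. *)
Definition back_shift (f : C -> C) (z : C) : C := (f z - circle_int f) / z.

Lemma L2_back_shift f : L2 f -> L2 (back_shift f).
Proof.
move=> fL; apply: L2V; apply: L2_eq (L2_lin (-1) (L2_cst (circle_int f)) fL) => t _.
by rewrite mulN1r addrC.
Qed.

Lemma H2_back_shift f : H2 f -> H2 (back_shift f).
Proof.
move=> [fL f0]; split; first exact: L2_back_shift.
move=> n n0.
have -> : fourier (back_shift f) n =
    fourier (fun z => z ^ (-1) * ((-1) * circle_int f + f z)) n.
  by apply: circle_int_eq => t _; rewrite /back_shift; congr (_ * _);
    rewrite mulN1r mulrC addrC.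
rewrite (fourier_shift (fun z => -1 * circle_int f + f z)) opprK.
rewrite (fourier_lin (-1) (f := fun=> circle_int f)) //; last exact: L2_cst.
have [n1|n1] := eqVneq (n + 1) 0.
  by rewrite n1 !fourier0 circle_int_cst mulN1r addNr.
rewrite fourier_cst// mulr0 add0r f0//; lia.
Qed.

Variable theta : C -> C.
Hypothesis thI : inner_function theta.

Let thD z : normc z < 1 -> derivable (theta : C^o -> C^o) z 1.
Proof.
by move=> z1; have [h _ _ _ _] := thI; apply: h; rewrite normr_normc ltcR.
Qed.

Lemma inner_bounded_disk : exists M, forall z, normc z < 1 -> normc (theta z) <= M.
Proof.
have [_ [M h] _ _ _] := thI; exists (Re M) => z z1.
by have := h z; rewrite !normr_normc ltcR lecE => /(_ z1) /andP[].
Qed.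

Lemma inner_unimodular : {ae mu, forall t, angles t -> normc (theta (cis t)) = 1}.
Proof.
have [_ _ _ _ h] := thI; apply: ae_circle_imp h => t _; rewrite normr_normc => h.
by have [] : (normc (theta (cis t)))%:C = (1 : R)%:C by exact: h.
Qed.

Lemma inner_bounded : bounded_circle theta.
Proof.
split; first by case: thI.
by exists 1; apply: ae_circle_imp inner_unimodular => t _ ->.
Qed.

Lemma inner_radial : {ae mu, forall t, angles t ->
  ccvg (fun k => theta ((1 - k.+1%:R^-1)%:C * cis t)) (theta (cis t))}.
Proof.
have [_ _ _ h _] := thI; apply: ae_circle_imp h => t _ h e e0.
have e0C : 0 < e%:C by rewrite ltcR.
move/cvgrPdist_lt : h => /(_ _ e0C) /nbhs_ballP[d /= d0 dP].
have : (fun k => k.+1%:R^-1) @ \oo --> (0 : R) by exact: cvg_harmonic.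
move/cvgrPdist_lt => /(_ _ d0); apply: filterS => k; rewrite sub0r normrN => kd.
rewrite normcB; have := dP (1 - k.+1%:R^-1); rewrite normr_normc ltcR; apply.
- by rewrite /ball/= opprB addrC subrK.
- by rewrite ltrBlDr ltrDl invr_gt0.
Qed.

Let unit_interval k : 0 <= (1 - k.+1%:R^-1 : R) < 1.
Proof.
rewrite ltrBlDr ltrDl invr_gt0 ltr0n andbT subr_ge0.
by rewrite invf_le1 ?ltr0n// ler1n.
Qed.

(** The mean of [theta (r z)] is [theta 0] for all [r < 1], and radial limits are
    bounded limits. *)
Lemma inner_mean : circle_int theta = theta 0.
Proof.
have [M thM] := inner_bounded_disk.
have := @circle_int_dct R (fun k z => theta ((1 - k.+1%:R^-1)%:C * z)) theta (fun=> 1) M.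
rewrite (@circle_int_eq R (fun z => theta z * 1) theta); last by move=> t _; rewrite mulr1.
move=> lim; apply: (ccvg_unique (lim _ _ _ _ _)).
- by move=> k; have [] := bounded_circle_dilate thD thM (unit_interval k).
- by case: inner_bounded.
- exact: L2_integrable (L2_cst 1).
- move=> k t _; apply: thM; have /andP[k0 k1] := unit_interval k.
  by rewrite normc_circle.
- exact: inner_radial.
- rewrite (_ : (fun k => _) = fun=> theta 0); first exact: ccvg_cst.
  apply/funext => k; rewrite -(holomorphic_mean thD thM (unit_interval k)).
  by apply: circle_int_eq => t _; rewrite mulr1.
Qed.

(** The analogue of [circle_int_dilate_orth] at radius 1, again by bounded radial
    limits. *)
Lemma inner_orth (g : C -> C) : L2 g ->
  (forall n : nat, circle_int (fun z => z ^+ n * g z) = 0) ->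
  circle_int (fun z => theta z * g z) = 0.
Proof.
move=> gL gn; have [M thM] := inner_bounded_disk.
have lim := @circle_int_dct R (fun k z => theta ((1 - k.+1%:R^-1)%:C * z)) theta g M.
apply: (ccvg_unique (lim _ _ _ _ _)).
- by move=> k; have [] := bounded_circle_dilate thD thM (unit_interval k).
- by case: inner_bounded.
- exact: L2_integrable.
- move=> k t _; apply: thM; have /andP[k0 k1] := unit_interval k.
  by rewrite normc_circle.
- exact: inner_radial.
- rewrite (_ : (fun k => _) = fun=> 0); first exact: ccvg_cst.
  apply/funext => k; exact: (circle_int_dilate_orth thD thM (unit_interval k)).
Qed.

Lemma L2_inner f : L2 f -> L2 (fun z => theta z * f z).
Proof. exact: L2M_bounded inner_bounded. Qed.

Lemma L2_theta : L2 theta. Proof. exact: bounded_L2 inner_bounded. Qed.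

(** Multiplicativity of [f |-> f(0)].  Subtracting from [g] its mean makes all its
    Fourier coefficients of index at most 0 vanish, so that [inner_orth] applies;
    the constant that was subtracted contributes through [inner_mean]. *)
Lemma inner_mul_mean g : H2 g ->
  circle_int (fun z => theta z * g z) = theta 0 * circle_int g.
Proof.
move=> gH; have gL := H2_L2 gH.
pose g' z := -1 * circle_int g + g z.
have g'H : H2 g' by exact: (H2_lin (-1) (H2_cst (circle_int g)) gH).
have th0 : circle_int (fun z => theta z * g' z) = 0.
  apply: inner_orth (H2_L2 g'H) _ => -[|n]; last exact: H2_exprn_int.
  rewrite (@circle_int_eq R _ (fun z => -1 * circle_int g + g z)); last first.
    by move=> t _; rewrite expr0 mul1r.
  rewrite circle_int_lin ?circle_int_cst ?mulN1r ?addNr//.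
  - exact: L2_integrable (L2_cst _).
  - exact: L2_integrable.
rewrite (@circle_int_eq R _ (fun z => circle_int g * theta z + theta z * g' z)); last first.
  by move=> t _; rewrite /g'; ring.
rewrite circle_int_lin ?th0 ?inner_mean ?addr0 1?mulrC//.
- exact: L2_integrable L2_theta.
- exact: L2_integrable (L2_inner (H2_L2 g'H)).
Qed.

Lemma H2_inner_mul g : H2 g -> H2 (fun z => theta z * g z).
Proof.
move=> gH; have gL := H2_L2 gH; split; first exact: L2_inner.
case=> // n _; rewrite fourierE NegzE opprK.
rewrite (@circle_int_eq R _ (fun z => theta z * (z ^+ n.+1 * g z))); last first.
  by move=> t _; rewrite mulrCA.
apply: inner_orth => [|k].
  exact: (L2M_bounded (bounded_exprz R n.+1)).
rewrite (@circle_int_eq R _ (fun z => z ^+ (k + n.+1)%N * g z)); last first.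
  by move=> t _; rewrite mulrA exprD.
by apply: H2_exprn_int => //; rewrite addnS.
Qed.

Lemma H2_theta : H2 theta.
Proof. by apply: H2_eq (H2_inner_mul (H2_cst 1)) => z; rewrite mulr1. Qed.

Lemma dot_inner f g : L2 f -> L2 g ->
  dot (fun z => theta z * f z) (fun z => theta z * g z) = dot f g.
Proof.
move=> fL gL; apply: circle_int_ae.
- by apply: circle_measurableM; [case: (L2_inner fL)|
    apply: circle_measurable_conj; case: (L2_inner gL)].
- by apply: circle_measurableM; [case: fL|apply: circle_measurable_conj; case: gL].
apply: ae_circle_imp inner_unimodular => t _ th1.
have thJ : theta (cis t) * (theta (cis t))^* = 1 by rewrite mulcJ th1 expr1n.
by rewrite rmorphM/= mulrACA thJ mul1r.
Qed.

Lemma dot_shift (f g : C -> C) : dot (fun z => z * f z) (fun z => z * g z) = dot f g.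
Proof.
apply: circle_int_eq => t _.
by rewrite rmorphM/= mulrACA cis_conjM mul1r.
Qed.

Lemma dot_shiftV (f g : C -> C) : dot (fun z => z * f z) g = dot f (fun z => g z / z).
Proof.
apply: circle_int_eq => t _.
by rewrite -conj_cis rmorphM/= conjCK; ring.
Qed.

Lemma dot_divl (f g : C -> C) : dot (fun z => f z / z) g = dot f (fun z => z * g z).
Proof.
apply: circle_int_eq => t _.
by rewrite rmorphM/= conj_cis mulrA.
Qed.

Lemma dot_cstr (c : C) (f : C -> C) : L2 f -> dot f (fun=> c) = c^* * circle_int f.
Proof.
move=> fL; rewrite /dot (@circle_int_eq R _ (fun z => c^* * f z)).
  exact: circle_intZ (L2_integrable fL).
by move=> t _; rewrite mulrC.
Qed.

Lemma dot_cstl (c : C) (f : C -> C) : L2 f -> dot (fun=> c) f = c * (circle_int f)^*.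
Proof. by move=> fL; rewrite (dotC fL (L2_cst c)) dot_cstr// rmorphM/= conjCK. Qed.

Lemma dot_theta g : L2 g -> dot theta (fun z => theta z * g z) = (circle_int g)^*.
Proof.
move=> gL; rewrite -[RHS]mul1r -dot_cstl// -(dot_inner (L2_cst 1) gL).
by apply: circle_int_eq => t _; rewrite mulr1.
Qed.

(** * The model space and its canonical elements *)

Local Notation K := (model_space theta).

Lemma model_space_H2 f : K f -> H2 f. Proof. by case. Qed.
Lemma model_space_L2 f : K f -> L2 f. Proof. by move=> /model_space_H2 /H2_L2. Qed.
Local Hint Resolve model_space_L2 model_space_H2 : core.

Lemma model_space_orth f g : K f -> H2 g -> dot f (fun z => theta z * g z) = 0.
Proof. by case=> _; apply. Qed.

Lemma model_space_orth_inner f : K f -> dot f theta = 0.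
Proof.
move=> fK; rewrite -(model_space_orth fK (H2_cst 1)); congr (dot f).
by apply/funext => z; rewrite mulr1.
Qed.

Lemma model_space_lin (a : C) f g : K f -> K g -> K (fun z => a * f z + g z).
Proof.
move=> fK gK; split; first by apply: H2_lin; exact: model_space_H2.
move=> h hH; rewrite dot_linl ?(model_space_orth fK)// ?(model_space_orth gK)// ?mulr0 ?addr0//.
- exact: model_space_L2.
- exact: model_space_L2.
- exact/L2_inner/H2_L2.
Qed.

(** Stated for [H2] and not only for the model space because [k0t theta] is the
    backward shift of [theta] itself, which is not in the model space. *)
Lemma back_shift_model_space_of_orth f : H2 f ->
  (forall g, H2 g -> dot f (fun z => theta z * (z * g z)) = 0) -> K (back_shift f).
Proof.
move=> fH f0; split; first exact: H2_back_shift.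
move=> g gH; rewrite dot_divl.
have fL := H2_L2 fH; have zgH := H2_shift gH.
have thL : L2 (fun z => theta z * (z * g z)) by exact/L2_inner/H2_L2.
rewrite (_ : (fun z => z * (theta z * g z)) = (fun z => theta z * (z * g z))); last first.
  by apply/funext => z; rewrite mulrCA.
rewrite (_ : (fun z => f z - circle_int f) = (fun z => -1 * circle_int f + f z)); last first.
  by apply/funext => z; rewrite mulN1r addrC.
rewrite (dot_linl (-1) (f := fun=> circle_int f) (L2_cst _) fL thL) f0// addr0.
rewrite dot_cstl// inner_mul_mean// (H2_exprn_int (n := 1) gH)//.
by rewrite mulr0 conjC0 !mulr0.
Qed.

Lemma k0tE : k0t theta = back_shift theta.
Proof. by apply/funext => z; rewrite /k0t /back_shift inner_mean. Qed.

Lemma model_space_k0t : K (k0t theta).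
Proof.
rewrite k0tE; apply: back_shift_model_space_of_orth H2_theta _ => g gH.
have zgH := H2_shift gH; have zgL := H2_L2 zgH.
rewrite (_ : theta = (fun z => theta z * 1)); last by apply/funext => z; rewrite mulr1.
rewrite (_ : (fun z => theta z * 1 * (z * g z)) = (fun z => theta z * (z * g z))); last first.
  by apply/funext => z; rewrite mulr1.
rewrite dot_inner//; last exact: L2_cst.
by rewrite dot_cstl// (H2_exprn_int (n := 1) gH)// conjC0 mulr0.
Qed.

Lemma model_space_k0 : K (k0 theta).
Proof.
have k0E : k0 theta = (fun z => - (theta 0)^* * theta z + 1).
  by apply/funext => z; rewrite /k0 addrC mulNr.
split; first by rewrite k0E; exact: H2_lin H2_theta (H2_cst 1).
move=> g gH; have gL := H2_L2 gH; have tgL := L2_inner gL.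
rewrite k0E dot_linl//; [|exact: L2_theta|exact: L2_cst].
rewrite dot_cstl// inner_mul_mean//.
rewrite (_ : dot theta _ = (circle_int g)^*).
  by rewrite rmorphM/= mul1r mulNr addNr.
exact: dot_theta.
Qed.

(** The component of [z f] along [theta H2] is the multiple [dot f (k0t theta)] of
    [theta]: multiplication by [z] creates just one new coefficient. *)
Definition shift_formula f (z : C) : C := z * f z - dot f (k0t theta) * theta z.

Lemma shift_formulaE f : shift_formula f = fun z => - dot f (k0t theta) * theta z + z * f z.
Proof. by apply/funext => z; rewrite /shift_formula mulNr addrC. Qed.

Lemma dot_k0t f : K f -> dot f (k0t theta) = dot (fun z => z * f z) theta.
Proof.
move=> fK; rewrite dot_shiftV k0tE.
rewrite (_ : back_shift theta = fun z => (- circle_int theta) * z ^ (-1) + theta z / z).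
  rewrite (dot_linr _ (L2_exprz R (-1)) (L2V L2_theta) (model_space_L2 fK)).
  have [_ f0] := model_space_H2 fK.
  have fm1 : dot f (fun z => z ^ (-1)) = 0 by exact: f0.
  by rewrite fm1 mulr0 add0r.
by apply/funext => z; rewrite /back_shift mulrBl addrC mulNr.
Qed.

(** Split [theta g] into [g(0) theta] and [z theta (back_shift g)].  The inner product of
    [z f] with the second part is that of [f] with [theta (back_shift g)], which is
    0; the inner product with the first part is cancelled by the subtracted
    multiple of [theta]. *)
Lemma model_space_shift_formula f : K f -> K (shift_formula f).
Proof.
move=> fK; have fH := model_space_H2 fK; have fL := H2_L2 fH; rewrite shift_formulaE.
split; first exact: H2_lin H2_theta (H2_shift fH).
move=> g gH; have gL := H2_L2 gH.
rewrite dot_linl; [|exact: L2_theta|exact: L2Z|exact: L2_inner].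
rewrite dot_theta//.
(* The splitting of [theta g] into [g(0) theta] and a multiple of [z]. *)
have gE : (fun z => theta z * g z) =1
    (fun z => circle_int g * theta z + theta z * (g z - circle_int g)).
  by move=> z; ring.
have bH := H2_back_shift gH; have bL := H2_L2 bH.
have -> : dot (fun z => z * f z) (fun z => theta z * g z) =
    dot (fun z => z * f z) (fun z => circle_int g * theta z + z * (theta z * back_shift g z)).
  apply: circle_int_eq => t _; congr (_ * _^*); rewrite gE; congr (_ + _).
  by rewrite /back_shift mulrCA [cis t * _]mulrC divfK// cis_neq0.
rewrite dot_linr; [|exact: L2_theta|exact: (L2Z (L2_inner bL))|exact: L2Z].
by rewrite dot_shift (model_space_orth fK bH) addr0 -dot_k0t// mulNr mulrC addNr.
Qed.

End Inner.

(** * The compressed shift and its adjoint *)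

Section Operators.
Variable R : realType.
Local Notation C := R[i].
Local Notation Re := (@complex.Re R).
Variable theta : C -> C.
Hypothesis thI : inner_function theta.
Local Notation K := (model_space theta).
Local Notation S := (comp_shift theta).
Local Notation S' := (shift_adj theta).
Implicit Types f g h p q r : C -> C.

Let KL2 f : K f -> L2 f := @model_space_L2 R theta f.
Local Hint Resolve KL2 : core.

(** Uniqueness for projections and adjoints: both are chosen among the solutions of
    a system of inner product equations, and two solutions have the same inner
    product with their own difference. *)
Lemma ae_circle_of_dot h h' : L2 h -> L2 h' ->
  dot h (fun z => -1 * h' z + h z) = dot h' (fun z => -1 * h' z + h z) -> ae_circle h h'.
Proof.
move=> hL hL' E; have dL := L2_lin (-1) hL' hL.
have d0 : dot (fun z => -1 * h' z + h z) (fun z => -1 * h' z + h z) = 0.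
  by rewrite dot_linl// E mulN1r addNr.
have := dot_self_eq0 dL; rewrite d0 => /(_ erefl).
apply: ae_circle_imp => t _ /eqP; rewrite mulN1r addrC subr_eq0 => /eqP //.
Qed.

(** The chosen projection of [z f] agrees with the explicit one, because
    [z f - shift_formula theta f] is a multiple of [theta], orthogonal to the model
    space. *)
Lemma comp_shift_spec f : K f -> K (S f) /\ ae_circle (S f) (shift_formula theta f).
Proof.
move=> fK; have eK := model_space_shift_formula thI fK.
have fzL : L2 (fun z => z * f z) by exact/L2Z/KL2.
have spec g : K g -> dot (fun z => z * f z - shift_formula theta f z) g = 0.
  move=> gK.
  rewrite (_ : (fun z => _) = fun z => dot f (k0t theta) * theta z + 0); last first.
    by apply/funext => z; rewrite /shift_formula opprB addrCA subrr.
  rewrite dot_linl//; [|exact: L2_theta|exact: L2_cst|exact: KL2].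
  rewrite dot0l addr0 (dotC (KL2 gK) (L2_theta thI)) (model_space_orth_inner gK).
  by rewrite conjC0 mulr0.
have [hK hspec] : [set h | K h /\ forall g, K g -> dot (fun z => z * f z - h z) g = 0] (S f).
  by apply: xgetPex; exists (shift_formula theta f).
split => //; apply: ae_circle_of_dot; [exact: KL2|exact: KL2|].
set d := fun z => _ + _.
have dK : K d by exact: model_space_lin.
have sub h : K h -> dot (fun z => z * f z - h z) d = 0 -> dot h d = dot (fun z => z * f z) d.
  move=> hK'; rewrite (_ : (fun z => _) = fun z => -1 * h z + z * f z); last first.
    by apply/funext => z; rewrite mulN1r addrC.
  rewrite dot_linl//; [|exact: KL2|exact: KL2].
  by rewrite mulN1r addrC => /eqP; rewrite subr_eq0 => /eqP.
by rewrite (sub _ hK (hspec _ dK)) (sub _ eK (spec _ dK)).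
Qed.

Lemma model_space_scale (a : C) f : K f -> K (fun z => a * f z).
Proof.
move=> fK; rewrite (_ : (fun z => _) = fun z => (a - 1) * f z + f z);
  first exact: model_space_lin.
by apply/funext => z; ring.
Qed.

Lemma model_space_back_shift f : K f -> K (back_shift f).
Proof.
by move=> fK; apply: (back_shift_model_space_of_orth thI (model_space_H2 fK)) => g gH;
  apply: (model_space_orth fK); exact: H2_shift.
Qed.

(** The backward shift is adjoint to the compressed shift: the terms in which they
    differ from multiplication and division by [z] involve only
    [dot theta g = 0] and [fourier f (-1) = 0]. *)
Lemma dot_shift_formula f g : K f -> K g -> dot (shift_formula theta f) g = dot f (back_shift g).
Proof.
move=> fK gK; have fL := KL2 fK; have gL := KL2 gK.
rewrite shift_formulaE dot_linl//; [|exact: L2_theta|exact: L2Z].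
rewrite (dotC gL (L2_theta thI)) (model_space_orth_inner gK) conjC0 mulr0 add0r dot_shiftV.
rewrite (_ : back_shift g = fun z => (- circle_int g) * z ^ (-1) + g z / z); last first.
  by apply/funext => z; rewrite /back_shift mulrBl addrC mulNr.
rewrite (dot_linr _ (L2_exprz R (-1)) (L2V gL) fL).
have fm1 : dot f (fun z => z ^ (-1)) = 0 by case: (model_space_H2 fK) => _; exact.
by rewrite fm1 mulr0 add0r.
Qed.

Lemma shift_adj_spec g : K g -> K (S' g) /\ ae_circle (S' g) (back_shift g).
Proof.
move=> gK; have bK := model_space_back_shift gK.
have spec f : K f -> dot (S f) g = dot f (back_shift g).
  move=> fK; have [sK sE] := comp_shift_spec fK.
  rewrite -dot_shift_formula//; apply: dot_ae sE; [exact: KL2| |exact: KL2].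
  exact/KL2/model_space_shift_formula.
have [hK hspec] : [set h | K h /\ forall f, K f -> dot (S f) g = dot f h] (S' g).
  by apply: xgetPex; exists (back_shift g).
split => //; apply: ae_circle_of_dot; [exact: KL2|exact: KL2|].
set d := fun z => _ + _.
have dK : K d by exact: model_space_lin.
rewrite (dotC (KL2 dK) (KL2 hK)) (dotC (KL2 dK) (KL2 bK)).
by rewrite -hspec// -spec.
Qed.

Lemma model_space_comp_shift f : K f -> K (S f). Proof. by case/comp_shift_spec. Qed.
Lemma model_space_shift_adj f : K f -> K (S' f). Proof. by case/shift_adj_spec. Qed.

Lemma circle_int_ae_L2 f g : L2 f -> L2 g -> ae_circle f g -> circle_int f = circle_int g.
Proof. by move=> [fm _] [gm _]; exact: circle_int_ae. Qed.

Lemma shift_adj_lin (a : C) p q r : K p -> K q -> K r ->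
  ae_circle r (fun z => a * p z + q z) ->
  ae_circle (S' r) (fun z => a * S' p z + S' q z).
Proof.
move=> pK qK rK E.
have [_ rE] := shift_adj_spec rK; have [_ pE] := shift_adj_spec pK.
have [_ qE] := shift_adj_spec qK.
have iE : circle_int r = a * circle_int p + circle_int q.
  rewrite (circle_int_ae_L2 (KL2 rK) (KL2 (model_space_lin thI a pK qK)) E).
  by rewrite circle_int_lin//; exact/L2_integrable/KL2.
apply: ae_circle_trans rE _; apply: ae_circle_trans (ae_circle_sym (ae_circle_lin a pE qE)).
by apply: ae_circle_imp E => t _ E; rewrite /back_shift E iE; ring.
Qed.

Lemma dot_k0 f : K f -> dot f (k0 theta) = circle_int f.
Proof.
move=> fK; have k0E : k0 theta = (fun z => - (theta 0)^* * theta z + 1).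
  by apply/funext => z; rewrite /k0 addrC mulNr.
rewrite k0E dot_linr; [|exact: L2_theta|exact: L2_cst|exact: KL2].
by rewrite (model_space_orth_inner fK) mulr0 add0r dot_cstr ?rmorph1 ?mul1r//; exact: KL2.
Qed.

Lemma circle_int_shift_formula f : K f ->
  circle_int (shift_formula theta f) = - dot f (k0t theta) * theta 0.
Proof.
move=> fK; rewrite shift_formulaE circle_int_lin.
- by rewrite (inner_mean thI) (H2_exprn_int (n := 1) (model_space_H2 fK))// addr0.
- exact/L2_integrable/L2_theta.
- exact/L2_integrable/L2Z/KL2.
Qed.

(** The defect identity [S^* S = I - k0t (x) k0t]. *)
Lemma shift_adj_shift f : K f ->
  ae_circle (S' (S f)) (fun z => - dot f (k0t theta) * k0t theta z + f z).
Proof.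
move=> fK; have [sK sE] := comp_shift_spec fK.
have [_ aE] := shift_adj_spec sK; apply: ae_circle_trans aE _.
have eK := model_space_shift_formula thI fK.
have iE := circle_int_ae_L2 (KL2 sK) (KL2 eK) sE.
apply: ae_circle_imp sE => t _ sE.
have c0 := cis_neq0 t.
by rewrite /back_shift sE iE circle_int_shift_formula// /shift_formula /k0t; field.
Qed.

Lemma dot_back_k0t f : K f ->
  dot (back_shift f) (k0t theta) = - (theta 0)^* * circle_int f.
Proof.
move=> fK; have fL := KL2 fK.
have thL := L2_theta thI.
rewrite (k0tE thI) /back_shift dot_divl.
transitivity (dot (fun z => -1 * circle_int f + f z) (fun z => - theta 0 * 1 + theta z)).
  apply: circle_int_eq => t _; have c0 := cis_neq0 t.
  rewrite (inner_mean thI) [cis t * _]mulrC divfK// mulr1 mulN1r.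
  by rewrite [- circle_int f + _]addrC [- theta 0 + _]addrC.
have bL : L2 (fun z : C => - theta 0 * 1 + theta z).
  exact: (L2_lin (- theta 0) (L2_cst 1) thL).
rewrite (dot_linl (-1) (f := fun=> circle_int f) (L2_cst _) fL bL).
rewrite (dot_linr (- theta 0) (L2_cst 1) thL fL) (model_space_orth_inner fK) addr0.
rewrite dot_cstl// (circle_int_lin (- theta 0) (f := fun=> 1) (g := theta)); last 2 first.
- exact/L2_integrable/L2_cst.
- exact/L2_integrable.
rewrite circle_int_cst (inner_mean thI) mulr1 addNr conjC0 !mulr0 add0r.
by rewrite dot_cstr// rmorph1 mul1r rmorphN.
Qed.

(** The defect identity [S S^* = I - k0 (x) k0]. *)
Lemma shift_shift_adj f : K f ->
  ae_circle (S (S' f)) (fun z => - circle_int f * k0 theta z + f z).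
Proof.
move=> fK; have [aK aE] := shift_adj_spec fK.
have [_ sE] := comp_shift_spec aK; apply: ae_circle_trans sE _.
have dE : dot (S' f) (k0t theta) = - (theta 0)^* * circle_int f.
  rewrite -dot_back_k0t//; apply: dot_ae aE; [exact: KL2| |].
    exact/KL2/model_space_back_shift.
  exact/KL2/model_space_k0t.
apply: ae_circle_imp aE => t _ aE.
have c0 := cis_neq0 t.
by rewrite /shift_formula dE aE /back_shift /k0; field.
Qed.

Variable B : (C -> C) -> C -> C.
Hypothesis BP : bounded_op K B.

Lemma bounded_op_model_space f : K f -> K (B f). Proof. by case: BP => h _ _; exact: h. Qed.

(** The norm bound, applied to the difference of two a.e. equal functions, shows
    that its image has norm 0. *)
Lemma bounded_op_ae p q : K p -> K q -> ae_circle p q -> ae_circle (B p) (B q).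
Proof.
move=> pK qK pq; have [_ Blin [M BM]] := BP.
pose d z := -1 * q z + p z.
have dK : K d by exact: model_space_lin.
have d0 : ae_circle d (fun=> 0).
  by apply: ae_circle_imp pq => t _ E; rewrite /d E mulN1r addNr.
have dd0 : dot d d = 0.
  by rewrite (dot_ae (KL2 dK) (L2_cst 0) (KL2 dK) d0) dot0l.
have Bd0 : ae_circle (B d) (fun=> 0).
  apply: dot_self_eq0; first exact/KL2/bounded_op_model_space.
  have := BM _ dK; rewrite /norm2 dd0 sqrtr0 mulr0 => h.
  have : Num.sqrt (Re (dot (B d) (B d))) = 0.
    by apply/eqP; rewrite eq_le h sqrtr_ge0.
  move/eqP; rewrite sqrtr_eq0 => h'; apply/eqP; rewrite eq_le h' andTb dot_self.
  rewrite mulr_ge0 ?invr_ge0 ?mulr_ge0 ?pi_ge0//.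
  by apply: Rintegral_ge0 => t _; rewrite sqr_ge0.
have := Blin (-1) q p qK pK; rewrite -/d => H.
have := ae_circle_trans (ae_circle_sym Bd0) H.
apply: ae_circle_imp => t _ /esym/eqP; rewrite mulN1r addrC subr_eq0 => /eqP //.
Qed.

Lemma bounded_op_lin (a : C) p q r : K p -> K q -> K r ->
  ae_circle r (fun z => a * p z + q z) -> ae_circle (B r) (fun z => a * B p z + B q z).
Proof.
move=> pK qK rK E; have [_ Blin _] := BP.
apply: ae_circle_trans (Blin a p q pK qK); apply: bounded_op_ae => //; exact: model_space_lin.
Qed.

(** The first identity is evaluated at [S f], that is, multiplied on the right by
    [S].  By [shift_adj_shift] the term [S^* B S^* S f] becomes
    [S^* B f - <f, k0t> S^* B k0t], and the rank one terms move to the other side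
    through [S^* k0 = - (theta 0)^* k0t] and [<S f, y> = <f, S^* y>]. *)
Lemma identity1_to_identity2 x y : K x -> K y -> identity1 theta B x y ->
  let u := fun z => - (S' (B (k0t theta)) z + theta 0 * x z) in
  let v := S' y in
  [/\ K u, K v & identity2 theta B u v].
Proof.
move=> xK yK id1 u v.
have kK := model_space_k0t thI; have BkK := bounded_op_model_space kK;
  have SBkK := model_space_shift_adj BkK.
have uK : K u.
  rewrite (_ : u = fun z => -1 * S' (B (k0t theta)) z + - theta 0 * x z).
    exact: (model_space_lin thI (-1) SBkK (model_space_scale (- theta 0) xK)).
  by apply/funext => z; rewrite /u; ring.
have vK : K v by exact: model_space_shift_adj.
split => // f fK.
pose c := dot f (k0t theta).
have [gK gE] := comp_shift_spec fK; have eK := model_space_shift_formula thI fK.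
have BfK := bounded_op_model_space fK.
have aK := model_space_shift_adj gK; have BaK := bounded_op_model_space aK.
have I := id1 _ gK.
have E1 := bounded_op_lin kK fK aK (shift_adj_shift fK).
have E2 := shift_adj_lin BkK BfK BaK E1.
have d1 : dot (S f) (k0 theta) = - c * theta 0.
  by rewrite dot_k0// (circle_int_ae_L2 (KL2 gK) (KL2 eK) gE) circle_int_shift_formula.
have d2 : dot (S f) y = dot f v.
  rewrite (dot_ae (KL2 gK) (KL2 eK) (KL2 yK) gE) dot_shift_formula//.
  have [_ vE] := shift_adj_spec yK.
  by apply: (dot_aer (KL2 fK) (KL2 (model_space_back_shift yK)) (KL2 vK)); exact: ae_circle_sym.
apply: ae_circle_imp (ae_circle_and I E2) => t _ [].
rewrite /rank1 d1 d2 -/c => /eqP; rewrite subr_eq => /eqP -> ->.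
rewrite /u; ring.
Qed.

(** Dually, the second identity is evaluated at [S^* f].  By [shift_shift_adj] the
    term [B S S^* f] becomes [B f - <f, k0> B k0], and the rank one terms move
    through [S k0t = - theta 0 k0] and [<S^* f, v> = <f, S v>]. *)
Lemma identity2_to_identity1 u v : K u -> K v -> identity2 theta B u v ->
  let x := fun z => B (k0 theta) z - (theta 0)^* * u z in
  let y := S v in
  [/\ K x, K y & identity1 theta B x y].
Proof.
move=> uK vK id2 x y.
have kK := model_space_k0 thI; have BkK := bounded_op_model_space kK.
have xK : K x.
  rewrite (_ : x = fun z => - (theta 0)^* * u z + B (k0 theta) z); first exact: model_space_lin.
  by apply/funext => z; rewrite /x mulNr addrC.
have yK : K y by exact: model_space_comp_shift.
split => // f fK.
have [gK gE] := shift_adj_spec fK; have bK := model_space_back_shift fK.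
have BfK := bounded_op_model_space fK.
have aK := model_space_comp_shift gK.
have I := id2 _ gK.
have E1 := bounded_op_lin kK fK aK (shift_shift_adj fK).
have d1 : dot (S' f) (k0t theta) = - (theta 0)^* * circle_int f.
  by rewrite -dot_back_k0t// (dot_ae (KL2 gK) (KL2 bK) (KL2 (model_space_k0t thI)) gE).
have d2 : dot (S' f) v = dot f y.
  have [_ yE] := comp_shift_spec vK; have eK := model_space_shift_formula thI vK.
  rewrite (dot_ae (KL2 gK) (KL2 bK) (KL2 vK) gE) (dotC (KL2 vK) (KL2 bK)).
  rewrite -dot_shift_formula// -(dotC (KL2 eK) (KL2 fK)).
  by apply: (dot_aer (KL2 fK) (KL2 eK) (KL2 yK)); exact: ae_circle_sym.
apply: ae_circle_imp (ae_circle_and I E1) => t _ [].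
rewrite /rank1 d1 d2 dot_k0// => I' E.
have -> : S' (B (S' f)) (cis t) = B (S (S' f)) (cis t) -
    (- (theta 0)^* * circle_int f * u (cis t) + dot f y * k0t theta (cis t)).
  by rewrite -I'; ring.
rewrite E /x; ring.
Qed.

End Operators.

(** * The equivalence *)

Unset Implicit Arguments.

Theorem lemma5p2 (R : realType) (theta : R[i] -> R[i])
    (B : (R[i] -> R[i]) -> R[i] -> R[i]) :
  inner_function theta -> nonconstant theta ->
  bounded_op (model_space theta) B ->
  [/\ (exists x y, [/\ model_space theta x, model_space theta y
         & identity1 theta B x y]) <->
      (exists u v, [/\ model_space theta u, model_space theta v
         & identity2 theta B u v]),
      forall x y, model_space theta x -> model_space theta y ->
        identity1 theta B x y ->
        let u := fun z =>
          - (shift_adj theta (B (k0t theta)) z + theta 0 * x z) in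
        let v := shift_adj theta y in
        [/\ model_space theta u, model_space theta v
          & identity2 theta B u v]
    & forall u v, model_space theta u -> model_space theta v ->
        identity2 theta B u v ->
        let x := fun z => B (k0 theta) z - (theta 0)^* * u z in
        let y := comp_shift theta v in
        [/\ model_space theta x, model_space theta y
          & identity1 theta B x y]].
Proof.
move=> thI _ BP.
have to2 := identity1_to_identity2 thI BP.
have to1 := identity2_to_identity1 thI BP.
split => //; split=> [[x [y [xK yK id1]]]|[u [v [uK vK id2]]]].
- by have := to2 _ _ xK yK id1; eexists; eexists; eassumption.
- by have := to1 _ _ uK vK id2; eexists; eexists; eassumption.
Qed.
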